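(* Let $F$ be an ordered graph with $\chi^<(F)\geq3$. Then \begin{align*} \delta_1(\mathsf{O\text{-}Spa}_F)&\leq1-\frac{1}{\chi^<_{\mathrm{cr}}(F)};\\ \delta_1(\mathsf{O\text{-}Div}_F)&\leq\begin{cases}1-\frac{1}{\chi^<(F)-1}&\text{if }\chi^<_{\mathrm{cr}}(F)<\chi^<(F),\\[2pt]1-\frac{1}{\chi^<(F)}&\text{otherwise};\end{cases}\\ \delta_1(\mathsf{O\text{-}Cov}_F)&\leq\begin{cases}1-\frac{1}{\chi^<(F)-1}&\text{if $F$ is an ordered cone},\\[2pt]1-\frac{1}{\chi^<(F)}&\text{otherwise}.\end{cases} \end{align*}
   Context: An ordered graph is a finite ($2$-uniform) graph whose vertices are equipped with a linear order. A homomorphism $\phi$ between ordered graphs (a map of vertices sending edges to edges) is order-preserving if $\phi(u)\leq\phi(v)$ whenever $u<v$; order-preserving copies correspond to injective order-preserving homomorphisms, and a perfect $F$-tiling of an ordered graph means a set of vertex-disjoint order-preserving copies of $F$ covering all vertices. Colourings: An interval $r$-colouring of an ordered graph $F$ is a partition of $V(F)$ into $r$ (possibly empty) intervals $V_1,\dots,V_r$, with all vertices of $V_i$ smaller than those of $V_j$ for $i<j$, such that no two vertices in the same interval are adjacent. $\chi^<(F)$ is the least $r$ such that $F$ has an interval $r$-colouring. For an unordered graph $B$ with $\chi(B)\geq2$, $\chi_{\mathrm{cr}}(B)=\frac{\chi(B)-1}{1-\tau(B)}$, where $\tau(B)$ is the relative size (divided by $|V(B)|$) of a smallest colour class over all proper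 $\chi(B)$-colourings of $B$. A complete $k$-partite unordered graph $B$ (for some $k$) is a bottle graph for $F$ if for every permutation $\sigma$ of the $k$ parts there is a $b$ such that the blow-up $B(b)$ ordered by $\sigma$ contains a perfect $F$-tiling; here $B(b)$ replaces each vertex of $B$ by $b$ new vertices and each edge by a complete bipartite graph, and its vertices are ordered so that the order between vertices of the $k$ parts is inherited from the ordering of the parts by $\sigma$ (each part being an interval). $\chi^<_{\mathrm{cr}}(F)=\min\{\chi_{\mathrm{cr}}(B): B\text{ is a bottle graph for }F\}$. $F$ is an ordered cone if $r=\chi^<(F)\geq2$ and for all distinct $i,j\in\{1,\dots,r+1\}$ there is an interval $(r+1)$-colouring of $F$ with colour classes $V_1,\dots,V_{r+1}$ such that $V_i$ contains a single vertex and there is no edge between $V_i$ and $V_j$. Thresholds: An $m$-digraph $H$ has a finite vertex set $V(H)$ and edge set $E(H)\subseteq V(H)^m$ (repeated entries allowed); $\mathrm{m}(v,e)=|\{i:e(i)=v\}|$. With $V(F)=\{1,\dots,m\}$ (natural order), $H^{\mathsf{Ord}}(F;G)$ is the $m$-digraph on $V(G)$ with an edge $(\phi(1),\dots,\phi(m))$ for every order-preserving homomorphism $\phi$ from $F$ to $G$. $\mathsf{Spa}_\rho$ is the set of $m$-digraphs $H$ admitting $w\colon E(H)\to[0,1]$ with $\sum_{e\in H}w(e)\,\mathrm{m}(v,e)\leq1$ for every $v$ and $\sum_{e\in H}w(e)\geq(1-\rho)|V(H)|/m$; $\mathsf{Div}$ is the set of digraphs $H$ admitting $w\colon E(H)\to\mathbb{Z}$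 with $\sum_{e\in H}w(e)\,\mathrm{m}(v,e)=1$ for all $v$; $\mathsf{Cov}$ is the set of digraphs in which every vertex $v$ has an edge $e$ with $\mathrm{m}(v,e)=1$. $\delta_1(\mathsf{O\text{-}Spa}_F)$, $\delta_1(\mathsf{O\text{-}Div}_F)$ and $\delta_1(\mathsf{O\text{-}Cov}_F)$ are the infima over all $\delta\in[0,1]$ such that for all $\mu>0$ and $n$ large enough (for $\mathsf{O\text{-}Div}_F$: $n$ large enough and divisible by $m$), every $n$-vertex ordered graph $G$ with minimum degree at least $(\delta+\mu)(n-1)$ satisfies $H^{\mathsf{Ord}}(F;G)\in\mathsf{Spa}_\mu$, $H^{\mathsf{Ord}}(F;G)\in\mathsf{Div}$ and $H^{\mathsf{Ord}}(F;G)\in\mathsf{Cov}$, respectively. *)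

(* Defs.v *)
From mathcomp Require Import all_boot all_order all_algebra all_fingroup.
From mathcomp Require Import boolp classical_sets reals.

Set Implicit Arguments.
Unset Strict Implicit.
Unset Printing Implicit Defensive.

Import Order.TTheory GRing.Theory Num.Theory.
Local Open Scope ring_scope.

Record graph (V : finType) := Graph {
  adj :> rel V;
  adj_sym : symmetric adj;
  adj_irr : irreflexive adj
}.

(* Every finite linear order is uniquely isomorphic to some 'I_n, so ordered
   graphs on n vertices are the graphs on 'I_n with its natural order. *)
Notation ograph n := (graph 'I_n).

Section Chromatic.
Variables (V : finType) (B : graph V).

Definition proper_col r (c : {ffun V -> 'I_r}) : bool :=
  [forall u, forall v, B u v ==> (c u != c v)].

Definition colourable r : bool := [exists c : {ffun V -> 'I_r}, proper_col c].

Lemma colourable_ex : exists r, colourable r.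
Proof.
exists #|V|; apply/existsP; exists [ffun v => enum_rank v].
apply/forallP=> u; apply/forallP=> v; apply/implyP=> uv.
rewrite !ffunE (inj_eq enum_rank_inj).
by apply: contraTneq uv => ->; rewrite adj_irr.
Qed.

Definition chi : nat := ex_minn colourable_ex.

(* Since classes have at most #|V| vertices and a proper chi-colouring exists,
   the default value #|V| of the iterated minimum does not affect it. *)
Definition min_class : nat :=
  \big[minn/#|V|]_(c : {ffun V -> 'I_chi} | proper_col c)
    \big[minn/#|V|]_(i < chi) #|[set v | c v == i]|.

Definition tau (R : realType) : R := min_class%:R / #|V|%:R.

Definition chi_cr (R : realType) : R := (chi%:R - 1) / (1 - tau R).

End Chromatic.

Section Constructions.
Variables (V : finType) (B : graph V).

Definition pullback_adj (W : finType) (f : W -> V) : rel W :=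
  fun x y => B (f x) (f y).

Lemma pullback_sym (W : finType) (f : W -> V) : symmetric (pullback_adj f).
Proof. by move=> x y; apply: adj_sym. Qed.

Lemma pullback_irr (W : finType) (f : W -> V) : irreflexive (pullback_adj f).
Proof. by move=> x; apply: adj_irr. Qed.

Definition pullback (W : finType) (f : W -> V) : graph W :=
  Graph (pullback_sym f) (pullback_irr f).

Definition blowup (b : nat) : graph (V * 'I_b)%type := pullback fst.

End Constructions.

(* The parts are the fibres of p; surjectivity says that they are nonempty. *)
Definition complete_partite (V : finType) (B : graph V) k (p : V -> 'I_k) : Prop :=
  (forall i, exists v, p v = i) /\ (forall u v, B u v = (p u != p v)).

Section IntervalColourings.
Variables (m : nat) (F : ograph m).

(* The condition on c says that all vertices of V_i precede those of V_j for
   i < j; this forces the (possibly empty) classes to be intervals. *)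
Definition interval_col r (c : {ffun 'I_m -> 'I_r}) : bool :=
  [forall u, forall v, (c u < c v)%N ==> (u < v)%N] && proper_col F c.

Definition interval_colourable r : bool :=
  [exists c : {ffun 'I_m -> 'I_r}, interval_col c].

Lemma interval_colourable_ex : exists r, interval_colourable r.
Proof.
exists m; apply/existsP; exists [ffun v => v]; apply/andP; split.
  by apply/forallP=> u; apply/forallP=> v; rewrite !ffunE implybb.
apply/forallP=> u; apply/forallP=> v; apply/implyP=> uv; rewrite !ffunE.
by apply: contraTneq uv => ->; rewrite adj_irr.
Qed.

Definition ochi : nat := ex_minn interval_colourable_ex.

Definition ordered_cone : bool :=
  (2 <= ochi)%N &&
  [forall i : 'I_ochi.+1, forall j : 'I_ochi.+1, (i != j) ==>
    [exists c : {ffun 'I_m -> 'I_ochi.+1},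
      [&& interval_col c,
          #|[set v | c v == i]| == 1%N &
          [forall u, forall v, (c u == i) && (c v == j) ==> ~~ F u v]]]].

End IntervalColourings.

Definition ord_hom m n (F : ograph m) (G : ograph n) (phi : {ffun 'I_m -> 'I_n}) : bool :=
  [forall u, forall v, F u v ==> G (phi u) (phi v)] &&
  [forall u : 'I_m, forall v : 'I_m, (u < v)%N ==> (phi u <= phi v)%N].

Definition perfect_tiling m n (F : ograph m) (G : ograph n)
    (T : {set {ffun 'I_m -> 'I_n}}) : Prop :=
  [/\ forall phi, phi \in T -> ord_hom F G phi /\ injective phi,
      forall phi psi, phi \in T -> psi \in T -> phi != psi ->
        [disjoint codom phi & codom psi]
    & forall v, exists2 phi, phi \in T & v \in codom phi].

Section BottleGraphs.
Variables (m : nat) (F : ograph m).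

(* The bijection f lists the vertices of the blow-up in increasing order; the
   order inside a part is immaterial, as vertices of one part are twins. *)
Definition bottle_graph (V : finType) (B : graph V) : Prop :=
  exists k (p : V -> 'I_k), complete_partite B p /\
    forall s : 'S_k, exists b : nat, (0 < b)%N /\
      exists f : 'I_#|{: V * 'I_b}| -> V * 'I_b,
        [/\ bijective f,
            forall x y : 'I_#|{: V * 'I_b}|,
              (x < y)%N -> (s (p (f x).1) <= s (p (f y).1))%N
          & exists T, perfect_tiling F (pullback (blowup B b) f) T].

(* chi_cr is only meaningful for chi(B) >= 2. The infimum agrees with the
   minimum, which is attained: this is a linear program over the rationals for
   each number k of parts, and only the least feasible k is relevant because
   chi_cr(B) lies in (k-1, k]. *)
Definition ochi_cr (R : realType) : R :=
  inf [set x : R | exists (V : finType) (B : graph V),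
         [/\ (2 <= chi B)%N, bottle_graph B & x = chi_cr B R]].

End BottleGraphs.

Notation mdigraph m V := {set {ffun 'I_m -> V}}.

Section Digraphs.
Variables (m : nat) (V : finType).
Implicit Type H : mdigraph m V.

Definition mult (v : V) (e : {ffun 'I_m -> V}) : nat := #|[set i | e i == v]|.

Definition Spa (R : realType) (rho : R) H : Prop :=
  exists w : {ffun 'I_m -> V} -> R,
    [/\ forall e, e \in H -> 0 <= w e <= 1,
        forall v, \sum_(e in H) w e * (mult v e)%:R <= 1
      & (1 - rho) * #|V|%:R / m%:R <= \sum_(e in H) w e].

Definition Div H : Prop :=
  exists w : {ffun 'I_m -> V} -> int,
    forall v, \sum_(e in H) w e * (mult v e)%:R = 1.

Definition Cov H : Prop := forall v, exists2 e, e \in H & mult v e = 1%N.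

End Digraphs.

Definition HOrd m n (F : ograph m) (G : ograph n) : mdigraph m 'I_n :=
  [set phi | ord_hom F G phi].

Definition min_degree_ge (R : realType) n (G : ograph n) (x : R) : Prop :=
  forall v, x <= #|[set u | G v u]|%:R.

Section Thresholds.
Variables (R : realType) (m : nat) (F : ograph m).

(* admissible restricts the orders n, and P may depend on the slack mu. *)
Definition threshold (admissible : pred nat)
    (P : R -> forall n, mdigraph m 'I_n -> Prop) : R :=
  inf [set d : R | 0 <= d <= 1 /\
    forall mu : R, 0 < mu -> exists n0 : nat, forall n : nat,
      (n0 <= n)%N -> admissible n -> forall G : ograph n,
        min_degree_ge G ((d + mu) * (n%:R - 1)) -> P mu n (HOrd F G)].

Definition delta_Spa : R := threshold predT (fun mu n H => Spa mu H).
Definition delta_Div : R := threshold (fun n => m %| n)%N (fun _ n H => Div H).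
Definition delta_Cov : R := threshold predT (fun _ n H => Cov H).

End Thresholds.

(* Main.v *)
(* Homomorphisms need not be injective, so an interval colouring of F followed by
   any increasing clique in G is an edge of the digraph; in particular the order
   of G plays no role once the vertices of a clique are sorted.

   Spa. By Farkas' lemma a perfect fractional tiling exists unless some signed
   weight y is nonnegative on all homomorphisms but has negative total. Build a
   clique greedily, each vertex minimising y in the common neighbourhood of the
   previous ones: the total of y is then at least a combination of the values on
   the clique, which the bottle graph (averaged over its larger parts) shows to
   be nonnegative.

   Div. As m divides n, it suffices that the lattice spanned by the
   homomorphisms contains all differences of unit vectors. Above 1 - 1/r this
   holds for the vertices u and u + 1, by moving a single vertex of F. If the
   bottle graph has parts of different sizes, every boundary between consecutive
   classes of interval r-colourings can be moved by one vertex, so all vertices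
   of an r-clique are interchangeable, and r-cliques connect everything.

   Cov. Every vertex lies in an (r + 1)-clique, or for cones in an (r + 1)-clique
   missing at most one edge at that vertex; colour F with a singleton class at
   the position of the vertex. *)

From HB Require Import structures.
Require Import Defs.
From mathcomp Require Import all_boot all_order all_algebra all_fingroup.
From mathcomp Require Import boolp classical_sets reals.
From mathcomp Require Import zify ring lra fintype finset.

Set Implicit Arguments.
Unset Strict Implicit.
Unset Printing Implicit Defensive.

Import Order.TTheory GRing.Theory Num.Theory.
Local Open Scope ring_scope.

(** * Farkas' lemma *)

(* Bartl's induction on the number of forms: if the form [a j] is needed,
   normalise a point [y] violating the claim without it to [a j y = 1] and
   project along [y] onto the kernel of [a j]. *)
Lemma farkas (R : realFieldType) (U : lmodType R) (I : eqType) (s : seq I)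
    (a : I -> {scalar U}) (c : {scalar U}) : uniq s ->
    (forall x, {in s, forall i, a i x <= 0} -> c x <= 0) ->
  exists2 w : I -> R, forall i, 0 <= w i &
    forall x, c x = \sum_(i <- s) w i * a i x.
Proof.
elim: s a c => [|j s IH] a c /=.
  move=> _ hc; exists (fun=> 0) => // x; rewrite big_nil.
  apply/eqP; rewrite eq_le hc //= -oppr_le0 -linearN.
  exact: hc.
move=> /andP[js us] hc.
have [h|] := pselect (forall x, {in s, forall i, a i x <= 0} -> c x <= 0).
  have [w w0 hw] := IH a c us h.
  exists (fun i => if i == j then 0 else w i) => [i|x]; first by case: ifP.
  rewrite big_cons eqxx mul0r add0r hw; apply: eq_big_seq => i si.
  by case: eqP => // ij; rewrite -ij si in js.
move=> /existsNP[y0] /not_implyP[hy0 /negP]; rewrite -ltNge => cy0.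
have ay0 : 0 < a j y0.
  rewrite ltNge; apply: contraTN cy0 => ajy; rewrite -leNgt; apply: hc => i.
  by rewrite inE => /predU1P[->|/hy0].
pose y := (a j y0)^-1 *: y0.
have ay : a j y = 1 by rewrite linearZ /= mulVf ?gt_eqF.
have cy : 0 <= c y by rewrite linearZ /= mulr_ge0 ?invr_ge0 // ltW.
have hy : {in s, forall i, a i y <= 0}.
  by move=> i /hy0 h; rewrite linearZ /= mulr_ge0_le0 ?invr_ge0 // ltW.
pose pr (x : U) := x - a j x *: y.
have prl (f : {scalar U}) : linear_for *%R (f \o pr).
  move=> k u v; rewrite /= /pr !(linearD, linearB, linearZ) /=; ring.
pose prm (f : {scalar U}) : {scalar U} :=
  HB.pack (f \o pr) (GRing.isLinear.Build R U R *%R (f \o pr) (prl f)).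
have prE (f : {scalar U}) x : prm f x = f x - a j x * f y.
  by rewrite /= /pr linearB linearZ.
have [x hx|w w0 hw] := IH (fun i => prm (a i)) (prm c) us.
  apply: hc => i; rewrite inE => /predU1P[->|/hx //].
  by rewrite /pr linearB linearZ /= ay mulr1 subrr.
(* The coefficient of [a j] is forced by equality at [y], where [a j y = 1]; it is nonnegative since
   [c y >= 0] and every other form is nonpositive at [y]. *)
exists (fun i => if i == j then c y - \sum_(i <- s) w i * a i y else w i).
  move=> i; case: ifP => // _; rewrite subr_ge0 (le_trans _ cy) //.
  rewrite big_seq; apply: sumr_le0 => k ks; rewrite mulr_ge0_le0 //; exact: hy.
move=> x; rewrite big_cons eqxx.
have -> : \sum_(i <- s) (if i == j then c y - \sum_(i <- s) w i * a i y
     else w i) * a i x = \sum_(i <- s) w i * a i x.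
  by apply: eq_big_seq => i si; case: eqP => // ij; rewrite -ij si in js.
have := hw x; rewrite prE => /eqP; rewrite subr_eq => /eqP ->.
under eq_bigr do rewrite prE mulrBr mulrCA.
by rewrite sumrB -mulr_sumr; ring.
Qed.

(** * Greedy cliques and the total of a weight *)

Section Greedy.
Variables (R : realFieldType) (V : finType) (G : graph V) (y : V -> R) (D : R).
Hypothesis D_ge0 : 0 <= D.
Hypothesis nonadj_le : forall v, #|[set u | ~~ G v u]|%:R <= D.

(* The vertices are picked greedily, each minimising [y] in the common
   neighbourhood [N] of the previous ones. *)
Lemma greedy_clique_step j : j%:R * D < #|V|%:R ->
  exists (s : seq V) (x : V) (N : {set V}),
    [/\ size s = j /\ uniq s, {in s &, forall u v, u != v -> G u v},
        forall z, z \in N -> y x <= y z /\ {in s, forall v, G v z},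
        x \in N /\ {in s, forall v, y v <= y x}
      & #|~: N|%:R <= j%:R * D /\
        D * (\sum_(v <- s) y v) - (j%:R * D - #|~: N|%:R) * y x
          <= \sum_(v in ~: N) y v].
Proof.
elim: j => [|j IH] hj.
  have /card_gt0P[x0 _]: (0 < #|V|)%N by rewrite -(ltr_nat R); lra.
  case: (arg_minP (P := predT) y (i0 := x0)) => // x _ hx.
  exists [::], x, [set: V]; split => //.
  - by move=> z _; split=> //; apply: hx.
  - by rewrite setCT cards0 big_nil big_set0; split; lra.
case: IH => [|s [x [N [[sz us] adj minx [xN lex] [cN sumN]]]]].
  by move: hj; rewrite -natr1 mulrDl mul1r => hj; have := D_ge0; lra.
pose N' := N :&: [set z | G x z].
have NN' : ~: N' = ~: N :|: (N :\: N').
  by apply/setP=> z; rewrite !inE; case: (z \in N); case: (G x z).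
have dis : [disjoint ~: N & N :\: N'].
  by rewrite -setI_eq0; apply/eqP/setP=> z; rewrite !inE; case: (z \in N); rewrite ?andbF.
have cN' : #|~: N'|%:R = #|~: N|%:R + #|N :\: N'|%:R :> R.
  by rewrite NN' cardsU (disjoint_setI0 dis) cards0 subn0 natrD.
have cD : #|N :\: N'|%:R <= D.
  apply: le_trans (nonadj_le x); rewrite ler_nat subset_leq_card //.
  by apply/subsetP=> z; rewrite !inE; case: (z \in N) => //=; rewrite andbT.
have cN'D : #|~: N'|%:R <= j.+1%:R * D by rewrite cN' -natr1; lra.
have /card_gt0P[x0 x0N] : (0 < #|N'|)%N.
  rewrite lt0n; apply/negP => /eqP N'0; move: hj.
  by rewrite -(cardsC N') N'0 add0n ltNge cN'D.
case: (arg_minP (P := fun z => z \in N') y x0N) => x' x'N' minx'.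
have /andP[x'N xx'] : (x' \in N) && G x x' by move: x'N'; rewrite !inE.
exists (rcons s x), x', N'; split.
- rewrite size_rcons sz rcons_uniq us andbT; split=> //.
  by apply/negP=> xs; have := (minx _ xN).2 _ xs; rewrite adj_irr.
- move=> u v; rewrite !mem_rcons !inE => /predU1P[->|us'] /predU1P[->|vs'].
  + by rewrite eqxx.
  + by move=> _; rewrite adj_sym; exact: (minx _ xN).2.
  + by move=> _; exact: (minx _ xN).2.
  + exact: adj.
- move=> z zN'; split; first exact: minx'.
  move: zN'; rewrite !inE => /andP[zN xz] v; rewrite mem_rcons inE => /predU1P[->//|].
  exact: (minx _ zN).2.
- split=> // v; rewrite mem_rcons inE.
  have xx := (minx _ x'N).1; case/predU1P=> [->//|/lex h].
  exact: le_trans h xx.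
- split=> //.
  have -> : \sum_(v in ~: N') y v = \sum_(v in ~: N) y v + \sum_(v in N :\: N') y v.
    rewrite (big_setID (~: N)) /=; congr (_ + _); apply: eq_bigl => z; rewrite !inE.
      by case: (z \in N); rewrite ?andbF.
    by case: (z \in N); rewrite ?andbT ?andbF.
  rewrite -cats1 big_cat big_seq1 /=.
  have hs : #|N :\: N'|%:R * y x <= \sum_(i in N :\: N') y i.
    rewrite mulr_natl -sumr_const; apply: ler_sum => z; rewrite inE => /andP[_ zN].
    exact: (minx _ zN).1.
  (* The minimum only grows and the coefficient [j.+1%:R * D - #|~: N'|%:R] is nonnegative, so [y x]
     may be replaced by [y x'] in the subtracted term. *)
  have := (minx _ x'N).1; rewrite -subr_ge0 => hy.
  have : 0 <= (j.+1%:R * D - #|~: N'|%:R) * (y x' - y x) by rewrite mulr_ge0 // subr_ge0.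
  by move: sumN hs; rewrite cN' -natr1; nra.
Qed.

(** Every vertex left in [N] weighs at least [y x]; adding them extends the bound outside [N] to the
    total over [V]. *)
Lemma greedy_clique j : j%:R * D < #|V|%:R ->
  exists (s : seq V) (x : V),
    [/\ size s = j /\ uniq (rcons s x),
        {in rcons s x &, forall u v, u != v -> G u v},
        {in s, forall v, y v <= y x}
      & D * (\sum_(v <- s) y v) + (#|V|%:R - j%:R * D) * y x <= \sum_v y v].
Proof.
move=> /greedy_clique_step[s [x [N [[sz us] adj minx [xN lex] [cN sumN]]]]].
exists s, x; split=> //.
- split=> //; rewrite rcons_uniq us andbT.
  by apply/negP=> xs; have := (minx _ xN).2 _ xs; rewrite adj_irr.
- move=> u v; rewrite !mem_rcons !inE => /predU1P[->|us'] /predU1P[->|vs'].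
  + by rewrite eqxx.
  + by move=> _; rewrite adj_sym; exact: (minx _ xN).2.
  + by move=> _; exact: (minx _ xN).2.
  + exact: adj.
- rewrite [X in _ <= X](bigID (fun z => z \in N)) /= -(cardsC N) natrD.
  have hs : #|N|%:R * y x <= \sum_(i in N) y i.
    rewrite mulr_natl -sumr_const; apply: ler_sum => z zN.
    exact: (minx _ zN).1.
  have -> : \sum_(i | i \notin N) y i = \sum_(i in ~: N) y i.
    by apply: eq_bigl => i; rewrite inE.
  by move: hs sumN; lra.
Qed.
End Greedy.

Lemma bigminn_le (I : finType) (P : pred I) (f : I -> nat) d j :
  P j -> (\big[minn/d]_(i | P i) f i <= f j)%N.
Proof.
move=> Pj; have := mem_index_enum j; elim: (index_enum I) => // i s IH.
rewrite inE big_cons => /predU1P[<-|/IH h]; first by rewrite Pj geq_min leqnn.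
by case: (P i) => //; rewrite geq_min h orbT.
Qed.

(** * Interval colourings and perfect tilings *)

Section IntervalCol.
Variables (m : nat) (F : ograph m).

Lemma interval_colP r (c : {ffun 'I_m -> 'I_r}) :
  reflect ((forall u v : 'I_m, (u <= v)%N -> (c u <= c v)%N) /\
           (forall u v : 'I_m, (u < v)%N -> F u v -> c u != c v))
          (interval_col F c).
Proof.
apply: (iffP andP) => -[mc pc]; split.
- move=> u v; rewrite leqNgt => uv; rewrite leqNgt; apply: contraNN uv.
  by have /forallP/(_ v)/forallP/(_ u)/implyP := mc.
- by move=> u v _ uv; have /forallP/(_ u)/forallP/(_ v)/implyP := pc; apply.
- apply/forallP=> u; apply/forallP=> v; apply/implyP; rewrite !ltnNge.
  by apply: contraNN; apply: mc.
- apply/forallP=> u; apply/forallP=> v; apply/implyP => uv.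
  have [lt|lt|/val_inj E] := ltngtP u v; first exact: pc.
    by rewrite eq_sym pc // adj_sym.
  by rewrite E adj_irr in uv.
Qed.

Lemma ochi_le r (c : {ffun 'I_m -> 'I_r}) : interval_col F c -> (ochi F <= r)%N.
Proof.
by rewrite /ochi => hc; case: ex_minnP => n _; apply; apply/existsP; exists c.
Qed.

Lemma ochi_ex : exists c : {ffun 'I_m -> 'I_(ochi F)}, interval_col F c.
Proof. by rewrite /ochi; case: ex_minnP => n /existsP. Qed.

Lemma ochi_le_size : (ochi F <= m)%N.
Proof.
apply: (@ochi_le m [ffun u => u]); apply/interval_colP; split=> u v.
  by rewrite !ffunE.
by move=> lt _; rewrite !ffunE; apply: contraTneq lt => ->; rewrite ltnn.
Qed.

(** Weak monotonicity of [h] is enough, which allows two classes to be sent to the same vertex of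
    [G], as in [Div_deg]. *)
Lemma HOrd_comp r n (G : ograph n) (c : {ffun 'I_m -> 'I_r}) (h : 'I_r -> 'I_n) :
  interval_col F c -> {homo h : a b / (a < b)%N >-> (a <= b)%N} ->
  (forall u v, F u v -> G (h (c u)) (h (c v))) ->
  [ffun u => h (c u)] \in HOrd F G.
Proof.
move=> /interval_colP[mc _] mh hG; rewrite inE; apply/andP; split.
  by apply/forallP=> u; apply/forallP=> v; apply/implyP; rewrite !ffunE; apply: hG.
apply/forallP=> u; apply/forallP=> v; apply/implyP => /ltnW/mc; rewrite !ffunE.
by rewrite leq_eqVlt => /predU1P[/val_inj->//|/mh].
Qed.

(** Copies are injective and each vertex lies in exactly one of them, so the double sum meets every
    vertex once. *)
Lemma tiling_sum n (G : ograph n) T (M : nmodType) (Y : 'I_n -> M) :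
  perfect_tiling F G T ->
  \sum_(phi in T) \sum_u Y (phi u) = \sum_x Y x.
Proof.
move=> [homT disT covT].
transitivity (\sum_(phi in T) \sum_(x in codom phi) Y x).
  apply: eq_bigr => phi /homT[_ inj].
  by rewrite -big_uniq ?big_map ?big_enum //= map_inj_uniq ?enum_uniq.
rewrite (exchange_big_dep predT) //=; apply: eq_bigr => x _.
have [phi phiT xphi] := covT x.
rewrite (big_pred1 phi) // => psi; apply/andP/eqP => [[psiT xpsi]|->//].
apply/eqP; apply: contraTT xpsi => ne.
by have /disjointFl-> := disT _ _ psiT phiT ne.
Qed.

(* Contracting the parts of a blow-up of [B] turns the copies of [F] in a
   perfect tiling into interval colourings, whose total class sizes are
   proportional to the part sizes of [B]; the common value ring of [Y] is left
   free as both real and integral weights are needed. *)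
Definition tiling_colourings (V : finType) k (p : V -> 'I_k) : Prop :=
  forall s : 'S_k, exists (b : nat) (cs : seq {ffun 'I_m -> 'I_k}),
      [/\ (0 < b)%N, {in cs, forall c, interval_col F c}
        & forall (R : pzRingType) (Y : 'I_k -> R),
            \sum_(c <- cs) \sum_u Y (c u) = b%:R * \sum_v Y (s (p v))].

Lemma bottle_profile (V : finType) (B : graph V) : bottle_graph F B ->
  exists k (p : V -> 'I_k), complete_partite B p /\ tiling_colourings p.
Proof.
move=> [k [p [Bp tilB]]]; exists k, p; split=> // s.
have [_ Badj] := Bp; have [b [b0 [f [bijf monf [T tilT]]]]] := tilB s.
(* A copy [phi] colours each vertex of [F] by the position under [s] of the part containing its
   image. *)
exists b, [seq [ffun u => s (p (f (phi u)).1)] | phi : {ffun _ -> _} <- enum T]; split=> //.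
  move=> _ /mapP[phi + ->]; rewrite mem_enum => phiT.
  have [homT _ _] := tilT; have [/andP[/forallP hom /forallP mon] inj] := homT _ phiT.
  apply/interval_colP; split=> u v.
    rewrite leq_eqVlt => /predU1P[/val_inj->//|lt].
    rewrite !ffunE; have := mon u => /forallP/(_ v)/implyP/(_ lt).
    by rewrite leq_eqVlt => /predU1P[/val_inj->//|/monf].
  move=> _ uv; rewrite !ffunE (inj_eq perm_inj).
  by have /forallP/(_ v)/implyP/(_ uv) := hom u; rewrite /= /pullback_adj /= /pullback_adj Badj.
move=> R Y; rewrite big_map big_enum /=.
under eq_bigr do under eq_bigr do rewrite ffunE.
rewrite (tiling_sum (fun x => Y (s (p (f x).1))) tilT).
have [g fK gK] := bijf.
rewrite (reindex g) /=; last by exists f => x _; [apply: gK|apply: fK].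
under eq_bigr do rewrite gK.
rewrite -(pair_big predT predT (fun v (_ : 'I_b) => Y (s (p v)))) /= mulr_sumr.
by apply: eq_bigr => v _; rewrite sumr_const card_ord mulr_natl.
Qed.

End IntervalCol.

(** * Colourings of complete multipartite graphs *)

Section CompletePartite.
Variables (V : finType) (B : graph V) (k : nat) (p : V -> 'I_k).
Hypothesis Bp : complete_partite B p.

Definition part (i : 'I_k) : {set V} := [set v | p v == i].

Lemma card_part_gt0 i : (0 < #|part i|)%N.
Proof. by have [v pv] := Bp.1 i; apply/card_gt0P; exists v; rewrite inE pv. Qed.

Lemma sum_part (M : nmodType) (Y : 'I_k -> M) :
  \sum_v Y (p v) = \sum_i Y i *+ #|part i|.
Proof.
rewrite (partition_big p predT) //=; apply: eq_bigr => i _.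
by rewrite -sumr_const; apply: eq_big => [v|v /eqP->//]; rewrite inE.
Qed.

Lemma card_parts : #|V| = (\sum_i #|part i|)%N.
Proof.
rewrite -sum1_card (partition_big p predT) //=; apply: eq_bigr => i _.
by rewrite -sum1_card; apply: eq_bigl => v; rewrite inE.
Qed.

Lemma part_col : proper_col B [ffun v => p v].
Proof.
by apply/forallP=> u; apply/forallP=> v; rewrite !ffunE Bp.2 implybb.
Qed.

(** Representatives of the parts form a [k]-clique, and the parts themselves are a proper
    colouring. *)
Lemma chi_partite : chi B = k.
Proof.
apply/eqP; rewrite eqn_leq; apply/andP; split.
  by rewrite /chi; case: ex_minnP => n _; apply; apply/existsP; exists [ffun v => p v]; apply: part_col.
rewrite /chi; case: ex_minnP => n /existsP[c /forallP hc] _.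
have [r pr] := fin_all_exists Bp.1.
suff inj : injective (c \o r) by rewrite -(card_ord k) -(card_ord n); exact: leq_card inj.
move=> i j /= /eqP eq; apply/eqP; apply: contraTT eq => ij.
by have /forallP/(_ (r j))/implyP := hc (r i); apply; rewrite Bp.2 !pr.
Qed.

(** Representatives of the parts use every colour exactly once. A vertex is adjacent to the
    representatives of all other parts, so only the colour of its own representative is left for
    it. *)
Lemma part_sub_class (c : {ffun V -> 'I_(chi B)}) (a : 'I_(chi B)) :
  proper_col B c -> exists i, part i \subset [set v | c v == a].
Proof.
move=> /forallP hc.
have adjne u v : p u != p v -> c u != c v.
  by move=> uv; have /forallP/(_ v)/implyP := hc u; apply; rewrite Bp.2.
have [r pr] := fin_all_exists Bp.1.
have inj : injective (c \o r).
  by move=> i j /= /eqP eq; apply/eqP; apply: contraTT eq => ij; rewrite adjne ?pr.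
have sz : (#|'I_(chi B)| <= #|'I_k|)%N by rewrite !card_ord chi_partite.
have [i /= ia] : exists i, (c \o r) i = a.
  by have /codomP[i ->] := inj_card_onto inj sz a; exists i.
exists i; apply/subsetP=> v; rewrite !inE => /eqP pv.
have [j /= jv] : exists j, (c \o r) j = c v.
  by have /codomP[j ->] := inj_card_onto inj sz (c v); exists j.
have [ij|ij] := eqVneq i j; first by rewrite -ia ij jv.
by have := @adjne (r j) v; rewrite pr pv eq_sym ij jv eqxx => /(_ isT).
Qed.

(** Every class of an optimal colouring contains a whole part, and the colouring by parts attains
    the resulting bound. *)
Lemma min_class_partite : (0 < k)%N ->
  exists2 i0, (forall i, #|part i0| <= #|part i|)%N & min_class B = #|part i0|.
Proof.
move=> k0; pose z := Ordinal k0.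
case: (@arg_minnP _ z predT (fun i => #|part i|)) => // i0 _ hi0.
exists i0 => [i|]; first exact: hi0.
apply/eqP; rewrite eqn_leq; apply/andP; split; last first.
  rewrite /min_class; elim/big_ind: _ => [|x y hx hy|c hc].
  - exact: max_card.
  - by rewrite leq_min hx.
  elim/big_ind: _ => [|x y hx hy|a _].
  - exact: max_card.
  - by rewrite leq_min hx.
  have [i /subset_leq_card] := part_sub_class a hc.
  exact/leq_trans/hi0.
have E := chi_partite; move: (part_col) (i0) => pc i1.
rewrite /min_class.
pose c : {ffun V -> 'I_(chi B)} := [ffun v => cast_ord (esym E) (p v)].
have hc : proper_col B c.
  apply/forallP=> u; apply/forallP=> v; apply/implyP; rewrite !ffunE Bp.2.
  by rewrite (inj_eq (@cast_ord_inj _ _ _)).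
apply: leq_trans (bigminn_le _ _ hc) _.
apply: leq_trans (bigminn_le _ _ (j := cast_ord (esym E) i1) _) _ => //.
apply: subset_leq_card; apply/subsetP=> v; rewrite !inE !ffunE.
by rewrite (inj_eq (@cast_ord_inj _ _ _)).
Qed.

End CompletePartite.

(** * Increasing enumerations *)

(** [s] sends an index to the rank of its value. It is the permutation of the parts under which the
    bottle graph is applied to an unsorted clique. *)
Lemma sort_inj k n (g : 'I_k -> 'I_n) : injective g ->
  exists (s : 'S_k) (h : 'I_k -> 'I_n),
    {homo h : a b / (a < b)%N >-> (a < b)%N} /\ forall i, g i = h (s i).
Proof.
move=> inj; pose below i := [set j | (g j < g i)%N].
have lt_below i j : (g i < g j)%N -> (#|below i| < #|below j|)%N.
  move=> ij; apply: proper_card; apply/properP; split.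
    by apply/subsetP=> l; rewrite !inE => /ltn_trans; apply.
  by exists i; rewrite !inE ?ltnn.
have lt_k i : (#|below i| < k)%N.
  rewrite -[ltnRHS]card_ord -cardsT; apply: proper_card; apply/properP; split.
    exact: subsetT.
  by exists i; rewrite !inE ?ltnn.
pose r i := Ordinal (lt_k i).
have rinj : injective r.
  move=> i j /(congr1 val) /= eq; apply: inj; apply: val_inj.
  by have [/lt_below|/lt_below|//] := ltngtP (g i) (g j); rewrite eq ltnn.
exists (perm rinj), (fun i => g ((perm rinj)^-1%g i)); split=> [a b|i]; last by rewrite permK.
apply: contraLR; rewrite -!leqNgt leq_eqVlt => /predU1P[/val_inj/inj/perm_inj->//|].
by move/lt_below/ltnW; rewrite -[X in (X <= _)%N]/(val (r _)) -[X in (_ <= X)%N]/(val (r _)) -!(permE rinj) !permKV.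
Qed.

Lemma increasing_enum n (K : {set 'I_n}) q : #|K| = q ->
  exists2 h : 'I_q -> 'I_n, {homo h : a b / (a < b)%N >-> (a < b)%N} &
    forall x, x \in K <-> exists i, h i = x.
Proof.
move=> cK; pose g (i : 'I_q) : 'I_n := enum_val (cast_ord (esym cK) i).
have gi : injective g by move=> i j /enum_val_inj/cast_ord_inj.
have [s [h [hh gh]]] := sort_inj gi; exists h => // x; split.
  move=> xK; exists (s (cast_ord cK (enum_rank_in xK x))).
  by rewrite -gh /g cast_ordK enum_rankK_in.
by case=> i <-; rewrite -(permKV s i) -gh; apply: enum_valP.
Qed.

(** * Fractional tilings *)

Section Spa.
Variables (R : realType) (m : nat) (F : ograph m).
Hypothesis m_gt0 : (0 < m)%N.

(** Farkas' lemma writes the total as a nonnegative combination of the edge sums. Evaluated at unit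
    vectors it says that every vertex is covered exactly once; at the constant [1], that the weights
    sum to [n / m]. *)
Lemma Spa_of_dual n (H : mdigraph m 'I_n) (rho : R) : 0 <= rho ->
  (forall y : 'I_n -> R, {in H, forall e : {ffun 'I_m -> 'I_n}, 0 <= \sum_u y (e u)} ->
    0 <= \sum_v y v) ->
  Spa rho H.
Proof.
move=> rho0 dual; pose U : lmodType R := {ffun 'I_n -> R^o}.
have al (e : {ffun 'I_m -> 'I_n}) : linear_for *%R (fun x : U => \sum_u x (e u) : R).
  move=> k x z; rewrite mulr_sumr -big_split; apply: eq_bigr => u _.
  by rewrite !ffunE.
have cl : linear_for *%R (fun x : U => \sum_v x v : R).
  move=> k x z; rewrite mulr_sumr -big_split; apply: eq_bigr => u _.
  by rewrite !ffunE.
pose a (e : {ffun 'I_m -> 'I_n}) : {scalar U} := HB.pack (fun x : U => \sum_u x (e u) : R)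
  (GRing.isLinear.Build R U R *%R _ (al e)).
pose c : {scalar U} := HB.pack (fun x : U => \sum_v x v : R)
  (GRing.isLinear.Build R U R *%R _ cl).
have [x hx|w w0 hw] := @farkas R U _ (enum H) a c (enum_uniq _).
  rewrite /c /= -oppr_ge0 -sumrN; apply: dual => e eH.
  by rewrite sumrN oppr_ge0; apply: hx; rewrite mem_enum.
have wE v : \sum_(e in H) w e * (mult v e)%:R = 1.
  have := hw [ffun z => (z == v)%:R]; rewrite big_enum /=.
  under eq_bigr do rewrite ffunE.
  rewrite (bigD1 v) //= eqxx big1 ?addr0 => [E|z /negPf->//].
  apply: etrans (esym E); apply: eq_bigr => e _; congr (_ * _).
  under eq_bigr do rewrite ffunE.
  by rewrite -natr_sum -big_mkcond sum1dep_card.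
have wH : \sum_(e in H) w e = n%:R / m%:R.
  apply/(canRL (mulfK _)); first by rewrite pnatr_eq0 -lt0n.
  have := hw [ffun=> 1]; rewrite big_enum /=.
  under eq_bigr do rewrite ffunE.
  rewrite sumr_const card_ord => ->; rewrite mulr_suml; apply: eq_bigr => e _.
  by under eq_bigr do rewrite ffunE; rewrite sumr_const card_ord.
exists w; split=> [e eH|v|].
(* The weight of [e] is at most 1 because [e] meets its own first entry, where the total is 1. *)
- rewrite w0 /= -(wE (e (Ordinal m_gt0))) (bigD1 e) //=.
  apply: (@le_trans _ _ (w e * (mult (e (Ordinal m_gt0)) e)%:R)); last first.
    by rewrite lerDl; apply: sumr_ge0 => i _; rewrite mulr_ge0.
  rewrite ler_peMr // ler1n card_gt0; apply/set0Pn.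
  by exists (Ordinal m_gt0); rewrite inE.
- by rewrite wE.
- rewrite wH card_ord -mulrA ler_piMl ?divr_ge0 //; lra.
Qed.

(** Sort the clique and follow the colourings for the resulting order of the parts by the sorted
    listing: these are edges, and their [y]-sums add up to [b] times the claimed quantity. *)
Lemma bottle_clique_ge0 (V : finType) k (p : V -> 'I_k) n
    (G : ograph n) (y : 'I_n -> R) (g : 'I_k -> 'I_n) :
  tiling_colourings F p ->
  {in HOrd F G, forall e : {ffun 'I_m -> 'I_n}, 0 <= \sum_u y (e u)} ->
  injective g -> (forall i j, i != j -> G (g i) (g j)) ->
  0 <= \sum_i #|part p i|%:R * y (g i).
Proof.
move=> profB hy inj adjg; have [s [h [hh gh]]] := sort_inj inj.
have [b [cs [b0 hcs /(_ R (y \o h)) /= E]]] := profB s.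
rewrite -(pmulr_rge0 _ (_ : 0 < b%:R)) ?ltr0n //.
suff -> : \sum_i #|part p i|%:R * y (g i) = \sum_v y (h (s (p v))).
  rewrite -E big_seq; apply: sumr_ge0 => c /hcs hc.
  have /hy : [ffun u => h (c u)] \in HOrd F G.
    apply: HOrd_comp => // [a a' /hh/ltnW//|u v uv].
    rewrite -(permKV s (c u)) -(permKV s (c v)) -!gh; apply: adjg.
    rewrite (inj_eq perm_inj).
    by have /andP[_ /forallP/(_ u)/forallP/(_ v)/implyP] := hc; apply.
  by congr (_ <= _); apply: eq_bigr => u _; rewrite ffunE.
under [RHS]eq_bigr do rewrite -gh.
rewrite (sum_part p (y \o g)); apply: eq_bigr => i _.
by rewrite mulr_natl.
Qed.

(* Averaging over the cyclic shifts of all parts but the smallest one replaces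
   the other part sizes by their mean. *)
Lemma bottle_sum_ge0 (V : finType) (B : graph V) n (G : ograph n) (y : 'I_n -> R) :
  bottle_graph F B -> (2 <= chi B)%N ->
  (forall v, chi_cr B R * #|[set u | ~~ G v u]|%:R <= n%:R) ->
  {in HOrd F G, forall e : {ffun 'I_m -> 'I_n}, 0 <= \sum_u y (e u)} ->
  0 <= \sum_v y v.
Proof.
move=> /bottle_profile[k [p [Bp profB]]]; rewrite /chi_cr (chi_partite Bp) => k2.
have [i0 hi0 mc] := min_class_partite Bp (ltnW k2).
rewrite /tau mc => hdeg hy.
case: n G y hdeg hy => [|n1] G y hdeg hy; first by rewrite big_ord0.
set n := n1.+1 in G y hdeg hy *.
case: k k2 p Bp profB i0 hi0 mc hdeg => [|[|K]] // _ p Bp profB i0 _ mc hdeg.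
set P := fun i => #|part p i|%:R : R; set N : R := #|V|%:R.
have P0 i : 0 < P i by rewrite ltr0n (card_part_gt0 Bp).
have NE : N = P i0 + \sum_(j < K.+1) P (lift i0 j).
  by rewrite /N (card_parts p) natr_sum (bigD1_ord i0).
set W := \sum_(j < K.+1) P (lift i0 j) in NE.
have W0 : 0 < W.
  rewrite /W (bigD1 ord0) //= ltr_wpDr ?P0 //.
  by apply: sumr_ge0 => j _; apply: ltW; apply: P0.
have N0 : 0 < N by rewrite NE addr_gt0.
have K0 : 0 < K.+1%:R :> R by rewrite ltr0n.
(* This is [n / chi_cr B R], because [chi_cr B R = K.+1%:R * N / W]. *)
pose D := n%:R * W / (K.+1%:R * N).
have n0 : 0 < n%:R :> R by rewrite ltr0n.
have D0 : 0 <= D by rewrite divr_ge0 ?mulr_ge0 // ltW.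
have hD v : #|[set u | ~~ G v u]|%:R <= D.
  rewrite /D ler_pdivlMr ?mulr_gt0 //.
  have := hdeg v; rewrite -/(P i0) -/N.
  have -> : (K.+2%:R - 1) / (1 - P i0 / N) = K.+1%:R * N / W.
    have -> : 1 - P i0 / N = W / N by rewrite NE; field; rewrite -NE gt_eqF.
    by rewrite -natr1; field; rewrite !gt_eqF.
  rewrite mulrAC ler_pdivrMr //; lra.
have [|s [x [[sz us] adjs lex hsum]]] := @greedy_clique _ _ G y D D0 hD K.+1.
  rewrite card_ord /D mulrA ltr_pdivrMr ?mulr_gt0 // NE.
  have -> : n%:R * (K.+1%:R * (P i0 + W)) = K.+1%:R * (n%:R * W) + n%:R * K.+1%:R * P i0 by ring.
  by rewrite ltrDl !mulr_gt0.
pose v (j : 'I_K.+1) := nth x s j.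
(* [g t] assigns the heaviest clique vertex [x] to the smallest part and shifts the others
   cyclically by [t]. *)
pose g (t : 'I_K.+1) (i : 'I_K.+2) := if unlift i0 i is Some j then v (j + t) else x.
have vs j : v j \in s by rewrite mem_nth ?sz.
have xs : x \notin s by move: us; rewrite rcons_uniq => /andP[].
have vinj : injective v.
  move=> i j /eqP; rewrite /v nth_uniq ?sz //; first by move/eqP/val_inj.
  by move: us; rewrite rcons_uniq => /andP[].
have ginj t : injective (g t).
  move=> i j; rewrite /g; case: (unliftP i0 i) => [i' ->|->]; case: (unliftP i0 j) => [j' ->|->] //.
  - by move/vinj/addIr->.
  - by move=> E; rewrite -E vs in xs.
  - by move=> E; rewrite E vs in xs.
have gs t i : g t i \in rcons s x.
  by rewrite mem_rcons inE /g; case: unliftP => [j _|_]; rewrite ?vs ?orbT ?eqxx.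
have hg t : 0 <= P i0 * y x + \sum_j P (lift i0 j) * y (v (j + t)).
  have := bottle_clique_ge0 profB hy (ginj t).
  rewrite (bigD1_ord i0) //= [g t i0]/g unlift_none => h.
  have {h} := h (fun i j ij => adjs _ _ (gs t i) (gs t j) (contra_neq (@ginj t i j) ij)).
  congr (_ <= _ + _); apply: eq_bigr => j _.
  by rewrite /g liftK.
have sumv : \sum_(z <- s) y z = \sum_j y (v j).
  by rewrite (big_nth x) sz big_mkord.
have key : 0 <= K.+1%:R * (P i0 * y x) + W * \sum_j y (v j).
  have : 0 <= \sum_t (P i0 * y x + \sum_j P (lift i0 j) * y (v (j + t))).
    exact: sumr_ge0.
  rewrite big_split /= sumr_const card_ord mulr_natl exchange_big /=.
  congr (_ <= _ + _); rewrite mulr_suml; apply: eq_bigr => j _.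
  by rewrite -mulr_sumr [in RHS](reindex_inj (addrI j)).
have yx : 0 <= y x.
  have hle : \sum_j y (v j) <= K.+1%:R * y x.
    rewrite mulr_natl -[K.+1 in X in _ <= X]card_ord -sumr_const.
    by apply: ler_sum => j _; apply: lex.
  rewrite -(pmulr_rge0 _ (_ : 0 < K.+1%:R * N)) ?mulr_gt0 //.
  apply: le_trans key _; rewrite -subr_ge0.
  have -> : K.+1%:R * N * y x - (K.+1%:R * (P i0 * y x) + W * \sum_j y (v j))
    = W * (K.+1%:R * y x - \sum_j y (v j)) by rewrite NE; ring.
  by rewrite mulr_ge0 ?subr_ge0 // ltW.
(* For this [D], since [N - W = P i0], the greedy lower bound is a nonnegative multiple of the
   expression in [key]. *)
apply: le_trans hsum; rewrite sumv card_ord.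
suff -> : D * (\sum_j y (v j)) + (n%:R - K.+1%:R * D) * y x =
  n%:R / (K.+1%:R * N) * (K.+1%:R * (P i0 * y x) + W * \sum_j y (v j)).
  by rewrite mulr_ge0 // divr_ge0 ?mulr_ge0 // ltW.
by rewrite /D NE; field; rewrite -NE nat1r !gt_eqF.
Qed.
End Spa.

(** * Extending cliques under a degree condition *)

Section Cliques.
Variables (V : finType) (G : graph V) (q : nat).
Hypotheses (q_gt0 : (0 < q)%N) (V_gt0 : (0 < #|V|)%N).
(* Minimum degree at least (1 - 1/q)|V| + 1, in terms of non-neighbours. *)
Hypothesis deg : forall v, (q * #|[set u | ~~ G v u]|.+1 <= #|V|)%N.

(** Each vertex of [S] excludes at most [|V|/q - 1] vertices. This number is nonnegative, so the
    worst case is [|S| = q], which still leaves [q] vertices. *)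
Lemma common_nbrs (S : {set V}) : (#|S| <= q)%N ->
  (q <= #|[set u | [forall v in S, G v u]]|)%N.
Proof.
move=> Sq; set C := [set u | _].
have cC : (#|~: C| <= \sum_(v in S) #|[set u | ~~ G v u]|)%N.
  rewrite -sum1_card.
  have -> : (\sum_(v in S) #|[set u | ~~ G v u]| = \sum_u \sum_(v in S) ~~ G v u)%N.
    rewrite exchange_big /=; apply: eq_bigr => v _; rewrite -sum1_card big_mkcond.
    by apply: eq_bigr => u _; rewrite inE; case: (G v u).
  rewrite [leqRHS](bigID (fun u => u \in ~: C)) /=; apply: leq_trans (leq_addr _ _).
  apply: leq_sum => u; rewrite !inE => /forall_inPn[v vS nvu].
  by rewrite (bigD1 v) //= nvu.
have le : (q * #|~: C| + #|S| * q <= #|S| * #|V|)%N.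
  apply: (@leq_trans (q * (\sum_(v in S) #|[set u | ~~ G v u]|) + #|S| * q)).
    by rewrite leq_add2r leq_mul2l cC orbT.
  rewrite big_distrr /= -!sum_nat_const -big_split /=; apply: leq_sum => v _.
  by rewrite -mulnSr.
have qV : (q <= #|V|)%N.
  have /card_gt0P[v _] := V_gt0; apply: leq_trans (deg v).
  by rewrite leq_pmulr.
by have := cardsC C; nia.
Qed.

(** Common neighbours are added one at a time. [S] may contain non-adjacent vertices, which serves
    to extend pairs that are not known to be edges. *)
Lemma clique_ext (S : {set V}) j : (#|S| + j <= q.+1)%N ->
  exists W : {set V}, [/\ #|W| = j, forall v w, v \in S -> w \in W -> G v w
    & forall v w, v \in W -> w \in W -> v != w -> G v w].
Proof.
elim: j => [|j IH] hS.
  by exists finset.set0; rewrite cards0; split=> // [v w _|v w]; rewrite inE.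
have [|W [cW SW WW]] := IH; first by rewrite (leq_trans _ hS) // addnS.
have SWq : (#|S :|: W| <= q)%N.
  by rewrite (leq_trans (leq_card_setU _ _)) // cW -ltnS -addnS.
have /card_gt0P[u] := leq_trans q_gt0 (common_nbrs SWq); rewrite inE => /forall_inP adju.
have uW : u \notin W by apply: contraTN isT => uW; have := adju u; rewrite inE uW orbT adj_irr => /(_ isT).
exists (u |: W); split.
- by rewrite cardsU1 uW cW.
- move=> v w vS; rewrite !inE => /predU1P[->|]; last exact: SW.
  by apply: adju; rewrite inE vS.
- move=> v w; rewrite !inE => /predU1P[->|vW] /predU1P[->|wW].
  + by rewrite eqxx.
  + by move=> _; rewrite adj_sym; apply: adju; rewrite inE wW orbT.
  + by move=> _; apply: adju; rewrite inE vW orbT.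
  + exact: WW.
Qed.

End Cliques.

(** Covers the situation where [v] and [w] share a clique [W] of neighbours but may themselves be
    non-adjacent. *)
Lemma near_clique_enum n (G : ograph n) (W : {set 'I_n}) (v w : 'I_n) r :
  #|W| = r -> v != w ->
  (forall u, u \in W -> G v u) -> (forall u, u \in W -> G w u) ->
  (forall u u', u \in W -> u' \in W -> u != u' -> G u u') ->
  exists (h : 'I_r.+2 -> 'I_n) (i j : 'I_r.+2),
    [/\ {homo h : a b / (a < b)%N >-> (a < b)%N}, h i = v, h j = w
      & forall a b, a != b -> ~~ ((a == i) && (b == j)) ->
          ~~ ((a == j) && (b == i)) -> G (h a) (h b)].
Proof.
move=> cW vw vW wW WW.
have nv : v \notin W by apply/negP => /vW; rewrite adj_irr.
have nw : w \notin W by apply/negP => /wW; rewrite adj_irr.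
have cK : #|v |: (w |: W)| = r.+2 by rewrite !cardsU1 !inE (negPf vw) nv nw cW.
have [h hh hK] := increasing_enum cK.
have [i hi] : exists i, h i = v by apply/hK; rewrite !inE eqxx.
have [j hj] : exists j, h j = w by apply/hK; rewrite !inE eqxx orbT.
have hinj : injective h.
  by move=> a b E; apply: val_inj; case: (ltngtP a b) => // /hh; rewrite E ltnn.
have memh a : a != i -> a != j -> h a \in W.
  move=> ai aj; have : h a \in v |: (w |: W) by apply/hK; exists a.
  by rewrite !inE -{1}hi -hj !(inj_eq hinj) (negPf ai) (negPf aj).
exists h, i, j; split=> // a b ab n1 n2.
have [ai|ai] := eqVneq a i; [|have [aj|aj] := eqVneq a j].
- rewrite ai hi; apply: vW; apply: memh; first by rewrite -ai eq_sym.
  by apply: contra n1 => /eqP->; rewrite ai !eqxx.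
- rewrite aj hj; apply: wW; apply: memh; last by rewrite -aj eq_sym.
  by apply: contra n2 => /eqP->; rewrite aj !eqxx.
- have [bi|bi] := eqVneq b i; [|have [bj|bj] := eqVneq b j].
  + by rewrite adj_sym bi hi; apply/vW/memh.
  + by rewrite adj_sym bj hj; apply/wW/memh.
  + by apply: WW; rewrite ?memh // (inj_eq hinj).
Qed.

(** * Covering every vertex *)

Section Cov.
Variables (m : nat) (F : ograph m).

(** Let [x] be the first vertex of colour at least [i], or the last vertex if there is none; earlier
    vertices keep their colours and later ones move up by one. A later vertex of new colour [i + 1]
    had old colour [i], which was then also the colour of [x], so it is no neighbour of [x]. *)
Lemma split_colouring r (c : {ffun 'I_m -> 'I_r}) (i : 'I_r.+1) :
  (0 < m)%N -> interval_col F c ->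
  exists (x : 'I_m) (c' : {ffun 'I_m -> 'I_r.+1}),
    [/\ interval_col F c', forall u, (c' u == i) = (u == x)
      & forall u, F x u -> c' u != i.+1 :> nat].
Proof.
move=> m0 /interval_colP[mc pc].
have [x [ltx gtx]] : exists x : 'I_m,
    (forall u : 'I_m, (u < x)%N -> (c u < i)%N) /\
    (forall u : 'I_m, (x < u)%N -> (i <= c x)%N).
  have [/existsP[x0 hx0]|/existsPn none] := boolP [exists x, (i <= c x)%N].
    case: (@arg_minnP _ x0 (fun x => (i <= c x)%N) val hx0) => x hx minx.
    exists x; split=> // u; rewrite !ltnNge; apply: contraNN; exact: minx.
  have lt : (m.-1 < m)%N by rewrite prednK.
  exists (Ordinal lt); split=> u /= hu; first by rewrite ltnNge none.
  by have := ltn_ord u; rewrite -[m in (_ < m)%N](prednK m0) ltnS leqNgt hu.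
pose c' := [ffun u : 'I_m => if (u < x)%N then widen_ord (leqnSn r) (c u)
                       else if u == x then i else lift ord0 (c u)].
have c'lt (u : 'I_m) : (u < x)%N -> c' u = c u :> nat by rewrite ffunE => ->.
have c'x : c' x = i by rewrite ffunE ltnn eqxx.
have c'eq (u : 'I_m) : u = x :> nat -> c' u = i :> nat by move/val_inj->; rewrite c'x.
have c'gt (u : 'I_m) : (x < u)%N -> c' u = (c u).+1 :> nat.
  by move=> xu; rewrite ffunE ltnNge (ltnW xu) -val_eqE gtn_eqF.
have gtu (u : 'I_m) : (x < u)%N -> (i <= c u)%N.
  by move=> xu; rewrite (leq_trans (gtx _ xu)) // mc // ltnW.
exists x, c'; split.
- apply/interval_colP; split=> u v.
    move=> uv; have := mc _ _ uv.
    have [lu|gu|eu] := ltngtP u x; have [lv|gv|ev] := ltngtP v x;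
      rewrite ?(c'eq _ eu) ?(c'eq _ ev) ?(c'lt _ lu) ?(c'lt _ lv) ?(c'gt _ gu) ?(c'gt _ gv) //;
      try lia.
    + by move=> _; have := ltx _ lu; lia.
    + by move=> _; have := gtu _ gv; lia.
  move=> uv Fuv; have := pc _ _ uv Fuv; have := mc _ _ (ltnW uv); rewrite -!val_eqE /=.
  have [lu|gu|eu] := ltngtP u x; have [lv|gv|ev] := ltngtP v x;
    rewrite ?(c'eq _ eu) ?(c'eq _ ev) ?(c'lt _ lu) ?(c'lt _ lv) ?(c'gt _ gu) ?(c'gt _ gv) //;
    try lia.
  + by have := ltx _ lu; lia.
  + by have := gtu _ gv; lia.
- move=> u; rewrite -!val_eqE /=.
  have [lu|gu|/val_inj ->] := ltngtP u x; last by rewrite c'x eqxx.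
    by rewrite (c'lt _ lu) ltn_eqF // ltx.
  by rewrite (c'gt _ gu) gtn_eqF // ltnS gtu.
- move=> u Fu; have [lu|gu|/val_inj eu] := ltngtP u x; last by rewrite eu adj_irr in Fu.
    by rewrite (c'lt _ lu); have := ltx _ lu; lia.
  rewrite (c'gt _ gu) eqSS; apply: contraTneq isT => E.
  have := pc _ _ gu Fu; rewrite -val_eqE /= neq_ltn E.
  by have := gtx _ gu; have := mc _ _ (ltnW gu); lia.
Qed.

Lemma Cov_clique r n (G : ograph n) (c : {ffun 'I_m -> 'I_r}) (h : 'I_r -> 'I_n) i :
  interval_col F c -> {homo h : a b / (a < b)%N >-> (a < b)%N} ->
  #|[set u | c u == i]| = 1%N ->
  (forall u v, F u v -> G (h (c u)) (h (c v))) ->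
  exists2 e, e \in HOrd F G & mult (h i) e = 1%N.
Proof.
move=> hc hh c1 hG; exists [ffun u => h (c u)].
  by apply: HOrd_comp => // a b /hh/ltnW.
rewrite -c1; apply: eq_card => u; rewrite !inE ffunE inj_eq // => a b E.
by apply: val_inj; case: (ltngtP a b) => // /hh; rewrite E ltnn.
Qed.

Lemma interval_col_neq r (c : {ffun 'I_m -> 'I_r}) u v :
  interval_col F c -> F u v -> c u != c v.
Proof. by move=> /andP[_ /forallP/(_ u)/forallP/(_ v)/implyP]; apply. Qed.

Lemma Cov_deg n (G : ograph n) : (0 < m)%N -> (0 < ochi F)%N ->
  (forall v, (ochi F * #|[set u | ~~ G v u]|.+1 <= n)%N) -> Cov (HOrd F G).
Proof.
move=> m0 r0 deg v.
(* From here [ochi F] is [r.+1], so the clique through [v] has [r + 2] vertices. *)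
have [c hc] := ochi_ex F; move: (ochi F) r0 deg c hc => [//|r] r0 deg c hc.
have n0 : (0 < #|'I_n|)%N by apply/card_gt0P; exists v.
have [||W [cW SW WW]] := @clique_ext _ G r.+1 r0 n0 _ [set v] r.+1.
- by move=> u; rewrite card_ord.
- by rewrite cards1.
have vW : v \notin W by apply/negP => /(SW v v); rewrite set11 adj_irr => /(_ isT).
have cK : #|v |: W| = r.+2 by rewrite cardsU1 vW cW.
have [h hh hK] := increasing_enum cK.
have [i hi] : exists i, h i = v by apply/hK; rewrite !inE eqxx.
have [x [c' [hc' c'i _]]] := split_colouring i m0 hc.
have hinj : injective h.
  by move=> a b E; apply: val_inj; case: (ltngtP a b) => // /hh; rewrite E ltnn.
rewrite -hi; apply: (Cov_clique hc' hh).
  by rewrite -(cards1 x); apply: eq_card => u; rewrite !inE c'i.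
move=> u w /(interval_col_neq hc'); rewrite -(inj_eq hinj).
have := (hK (h (c' u))).2 (ex_intro _ _ erefl).
have := (hK (h (c' w))).2 (ex_intro _ _ erefl).
rewrite !inE => /predU1P[->|wW] /predU1P[->|uW].
- by rewrite eqxx.
- by move=> _; rewrite adj_sym SW ?set11.
- by move=> _; rewrite SW ?set11.
- exact: WW.
Qed.

Lemma Cov_deg_cone n (G : ograph n) : ordered_cone F -> (3 <= ochi F)%N ->
  (forall v, ((ochi F).-1 * #|[set u | ~~ G v u]|.+1 <= n)%N) -> Cov (HOrd F G).
Proof.
move=> /andP[_ /forallP cone] r3 deg v.
move: (ochi F) cone r3 deg => [//|r] /= cone; rewrite ltnS => r2 deg.
have r0 : (0 < r)%N by apply: ltnW.
have n0 : (0 < #|'I_n|)%N by apply/card_gt0P; exists v.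
have deg' u : (r * #|[set w | ~~ G u w]|.+1 <= #|'I_n|)%N by rewrite card_ord.
have [|W [cW SW WW]] := @clique_ext _ G r r0 n0 deg' [set v] r; first by rewrite cards1.
have := common_nbrs r0 n0 deg' (_ : (#|W| <= r)%N); rewrite cW leqnn => /(_ isT) cC.
set C := [set _ | _] in cC.
(* [W] has at least [r >= 2] common neighbours, so one of them differs from [v]; this is where
   [ochi F >= 3] enters. *)
have /card_gt0P[w] : (0 < #|C :\ v|)%N by have := cardsD1 v C; case: (v \in C); lia.
rewrite !inE => /andP[wv /forall_inP wW].
have [|||h [i [j [hh hi hj hG]]]] := @near_clique_enum _ G W v w r cW _ _ _ WW.
- by rewrite eq_sym.
- by move=> u; apply: SW; rewrite set11.
- by move=> u /wW; rewrite adj_sym.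
have ij : i != j by apply: contraNneq wv => ij; rewrite -hi -hj ij.
(* The positions of [v] and [w] cannot be prescribed, hence the cone condition for every ordered
   pair of classes. *)
have /forallP/(_ j)/implyP/(_ ij)/existsP[c /and3P[hc /eqP c1 /forallP cij]] := cone i.
rewrite -hi; apply: (Cov_clique hc hh c1) => u u' uu'; apply: hG.
- exact: interval_col_neq uu'.
- have /forallP/(_ u')/implyP H := cij u.
  by apply: contraTN uu' => /H.
- have /forallP/(_ u)/implyP H := cij u'.
  by apply: contraTN uu'; rewrite andbC adj_sym => /H.
Qed.
End Cov.

(** * Integer combinations of edges *)

Section Lattice.
Variables (m : nat) (V : finType) (H : mdigraph m V).

(** [Div H] asks that the all-ones vector lie in this span. *)
Definition lattice (z : V -> int) : Prop :=
  exists w : {ffun 'I_m -> V} -> int,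
    forall v, \sum_(e in H) w e * (mult v e)%:R = z v.

Lemma lattice_ext z z' : z =1 z' -> lattice z -> lattice z'.
Proof. by move=> E [w hw]; exists w => v; rewrite hw. Qed.

Lemma lattice_lin (a : int) z z' :
  lattice z -> lattice z' -> lattice (fun v => z v + a * z' v).
Proof.
move=> [w hw] [w' hw']; exists (fun e => w e + a * w' e) => v.
rewrite -hw -hw' mulr_sumr -big_split; apply: eq_bigr => e _.
by rewrite mulrDl mulrA.
Qed.

Lemma lattice0 : lattice (fun=> 0).
Proof. by exists (fun=> 0) => v; rewrite big1 // => e _; rewrite mul0r. Qed.

Lemma lattice_sum (I : finType) (z : I -> V -> int) :
  (forall i, lattice (z i)) -> lattice (fun v => \sum_i z i v).
Proof.
move=> hz; elim: (index_enum I) => [|i s IH].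
  by apply: lattice_ext lattice0 => v; rewrite big_nil.
apply: lattice_ext (lattice_lin 1 (hz i) IH) => v.
by rewrite big_cons mul1r.
Qed.

Lemma lattice_mult e : e \in H -> lattice (fun v => (mult v e)%:R).
Proof.
move=> eH; exists (fun e' => (e' == e)%:R) => v.
rewrite (bigD1 e) //= eqxx mul1r big1 ?addr0 // => e' /andP[_ /negPf->].
by rewrite mul0r.
Qed.

Definition transferable (a b : V) : Prop :=
  lattice (fun v => (v == a)%:R - (v == b)%:R).

Lemma transferable_refl a : transferable a a.
Proof. by apply: lattice_ext lattice0 => v; rewrite subrr. Qed.

Lemma transferable_sym a b : transferable a b -> transferable b a.
Proof.
by move=> h; apply: lattice_ext (lattice_lin (-1) lattice0 h) => v; ring.
Qed.

Lemma transferable_trans a b c :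
  transferable a b -> transferable b c -> transferable a c.
Proof.
by move=> h h'; apply: lattice_ext (lattice_lin 1 h h') => v; ring.
Qed.

Lemma multE v (e : {ffun 'I_m -> V}) : (mult v e)%:R = \sum_u (v == e u)%:R :> int.
Proof.
rewrite -natr_sum -big_mkcond sum1dep_card; congr _%:R.
by apply: eq_card => u; rewrite !inE eq_sym.
Qed.

Lemma transferable_edges e e' x : e \in H -> e' \in H ->
  (forall u, u != x -> e u = e' u) -> transferable (e x) (e' x).
Proof.
move=> eH e'H E.
apply: lattice_ext (lattice_lin (-1) (lattice_mult eH) (lattice_mult e'H)) => v.
rewrite !multE (bigD1 x) //= [in X in _ + _ * X](bigD1 x) //=.
have -> : \sum_(u | u != x) (v == e u)%:R = \sum_(u | u != x) (v == e' u)%:R :> int.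
  by apply: eq_bigr => u /E->.
ring.
Qed.

(** Let [#|V| = d * m]. Transferring all weight to [o] turns the all-ones vector into [d * m] copies
    of [o], and [d] times the vector of [e0] into the same. *)
Lemma Div_transferable e0 : e0 \in H -> (m %| #|V|)%N ->
  (forall a b, transferable a b) -> Div H.
Proof.
move=> e0H /dvdnP[d Vd] tr.
case: (posnP #|V|) => [V0|/card_gt0P[o _]].
  by exists (fun=> 0) => v; have := card0_eq V0 v.
have L1 := lattice_sum (fun a => tr a o).
have L2 := lattice_sum (fun u => tr (e0 u) o).
apply: lattice_ext (lattice_lin d%:R L1 (lattice_lin (-1) (lattice_mult e0H) L2)) => v.
rewrite multE !sumrB !sumr_const card_ord -[#|_|]/#|V| Vd.
rewrite (bigD1 v) //= eqxx big1 => [|a /negPf]; last by rewrite eq_sym => ->.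
rewrite mulrnA; set z := (v == o)%:R.
rewrite -(mulr_natr (z *+ d)) -(mulr_natr z d) -(mulr_natr z m) mulr1n.
by ring.
Qed.

End Lattice.

(** * Integer tilings and movable class boundaries *)

Section Div.
Variables (m : nat) (F : ograph m).

(* Consecutive vertices [u], [u + 1] with a common clique of [ochi F - 1]
   neighbours: move the singleton class of a split colouring from one to the
   other. *)
Lemma Div_deg n (G : ograph n) : (0 < m)%N -> (2 <= ochi F)%N -> (0 < n)%N ->
  (forall v, (ochi F * #|[set u | ~~ G v u]|.+1 <= n)%N) -> (m %| n)%N ->
  Div (HOrd F G).
Proof.
move=> m0 r2 n1 deg mn.
have [c hc] := ochi_ex F; move: (ochi F) r2 deg c hc => [|[//|r]] // _ deg c hc.
have n0 : (0 < #|'I_n|)%N by rewrite card_ord.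
have deg' u : (r.+2 * #|[set w | ~~ G u w]|.+1 <= #|'I_n|)%N by rewrite card_ord.
have [e0 e0H] : exists e, e \in HOrd F G.
  have [|W [cW _ WW]] := @clique_ext _ G r.+2 isT n0 deg' finset.set0 r.+2.
    by rewrite cards0.
  have [h hh hK] := increasing_enum cW.
  exists [ffun u => h (c u)]; apply: HOrd_comp => // [a b /hh/ltnW//|u v uv].
  apply: WW; try by apply/hK; eexists.
  apply: contraNneq (interval_col_neq hc uv) => E; apply/eqP/val_inj.
  by case: (ltngtP (c u) (c v)) => // /hh; rewrite E ltnn.
have step (u u' : 'I_n) : u.+1 = u' :> nat -> transferable (HOrd F G) u u'.
  move=> uu'; have ne : u != u' by rewrite -val_eqE /= -uu' neq_ltn ltnSn.
  have [|W [cW SW WW]] := @clique_ext _ G r.+2 isT n0 deg' [set u; u'] r.+1.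
    by rewrite cards2 ne.
  have [||h [i [j [hh hi hj hG]]]] := near_clique_enum cW ne _ _ WW.
  - by move=> w; apply: SW; rewrite !inE eqxx.
  - by move=> w; apply: SW; rewrite !inE eqxx orbT.
  (* No vertex lies strictly between [u] and its successor [u'], so their positions in [h] are
     consecutive. *)
  have ij : i.+1 = j :> nat.
    have lt_ij : (i < j)%N.
      rewrite ltnNge leq_eqVlt; apply/negP => /predU1P[/val_inj E|/hh].
        by move: ne; rewrite -hi -hj E eqxx.
      by rewrite hi hj -uu' ltnNge leqnSn.
    apply/eqP; rewrite eqn_leq lt_ij leqNgt; apply/negP => lt.
    have ltr : (i.+1 < r.+3)%N by apply: leq_ltn_trans lt_ij _.
    have /hh : (i < Ordinal ltr)%N by [].
    have /hh : (Ordinal ltr < j)%N by [].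
    by rewrite hi hj; lia.
  have [x [c' [hc' c'i c'x]]] := split_colouring i m0 hc.
  have nij w w' : F w w' -> ~~ ((c' w == i) && (c' w' == j)).
    move=> Fww'; rewrite c'i; apply/negP => /andP[/eqP E /eqP E'].
    by have := c'x w'; rewrite -E Fww' E' ij eqxx => /(_ isT).
  have nji w w' : F w w' -> ~~ ((c' w == j) && (c' w' == i)).
    by rewrite adj_sym andbC; apply: nij.
  (* [h'] sends both classes [i] and [j] to [u']. It stays weakly increasing, and no edge of [F]
     joins these classes: class [i] is the single vertex [x], whose neighbours avoid class
     [i + 1]. *)
  pose h' a := if a == i then u' else h a.
  have eH : [ffun w => h (c' w)] \in HOrd F G.
    apply: HOrd_comp => // [a b /hh/ltnW//|w w' Fww'].
    by apply: hG; rewrite ?nij ?nji ?(interval_col_neq hc').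
  have e'H : [ffun w => h' (c' w)] \in HOrd F G.
    apply: HOrd_comp => // [a b ab|w w' Fww'].
      rewrite /h'; case: eqP ab => [->|ai] ab; case: eqP => [bi|bi].
      - by rewrite bi ltnn in ab.
      - by rewrite -uu' -hi hh.
      - by move: ab; rewrite bi => /hh; rewrite hi; lia.
      - by apply/ltnW/hh.
    have := nij _ _ Fww'; have := nji _ _ Fww'; have := interval_col_neq hc' Fww'.
    rewrite /h'; case: (eqVneq (c' w) i) => [->|ai]; case: (eqVneq (c' w') i) => [->|bi] //=.
    - move=> _ _ bj; rewrite -hj; apply: hG.
      + by rewrite eq_sym.
      + by rewrite (negPf bj) andbF.
      + by rewrite (negPf bi) andbF.
    - rewrite andbT => _ aj _; rewrite -hj; apply: hG => //.
      + by rewrite (negPf ai).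
      + by rewrite (negPf aj).
    - by move=> ab _ _; apply: hG; rewrite ?(negPf ai) ?(negPf bi) ?andbF.
  have := @transferable_edges _ _ _ _ _ x eH e'H.
  have cx : c' x == i by rewrite c'i.
  rewrite !ffunE /h' cx (eqP cx) hi; apply => w wx; rewrite !ffunE.
  by rewrite c'i (negPf wx).
have tr0 (a : 'I_n) : transferable (HOrd F G) (Ordinal n1) a.
  case: a => a; elim: a => [|a IH] lt.
    by have -> : Ordinal n1 = Ordinal lt; [apply: val_inj|apply: transferable_refl].
  by apply: transferable_trans (IH (ltnW lt)) _; apply: step.
apply: (Div_transferable e0H); rewrite ?card_ord // => a b.
exact: transferable_trans (transferable_sym (tr0 a)) (tr0 b).
Qed.

(* Recolouring one vertex at a time from [c'] (made pointwise smaller than [c])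
   to [c]. *)
Lemma splice_colouring r (c c' : {ffun 'I_m -> 'I_r}) (x : 'I_m) (a : 'I_r) :
  interval_col F c -> interval_col F c' -> (c' x <= a)%N -> (a <= c x)%N ->
  exists d : {ffun 'I_m -> 'I_r}, [/\ interval_col F d, d x = a &
    forall u, u != x -> d u = if (u < x)%N then (if (c u <= c' u)%N then c u else c' u) else c u].
Proof.
move=> /interval_colP[mc pc] /interval_colP[mc' pc'] xa ax.
(* Before [x] the colour is the pointwise minimum, bounded by [c' x <= a]; after [x] it is that of
   [c], at least [c x >= a]. Along edges the corresponding inequalities are strict. *)
pose d := [ffun u => if u == x then a else
   if (u < x)%N then (if (c u <= c' u)%N then c u else c' u) else c u].
have dx : d x = a by rewrite ffunE eqxx.
have deq (u : 'I_m) : u = x :> nat -> d u = a :> nat by move/val_inj->; rewrite dx.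
have dlt (u : 'I_m) : (u < x)%N -> d u = minn (c u) (c' u) :> nat.
  by move=> ux; rewrite ffunE ux -val_eqE ltn_eqF //= /minn; case: ltngtP => // ->.
have dgt (u : 'I_m) : (x < u)%N -> d u = c u :> nat.
  by move=> ux; rewrite ffunE ltnNge (ltnW ux) -val_eqE gtn_eqF.
exists d; split=> // [|u ux]; last by rewrite ffunE (negPf ux).
apply/interval_colP; split=> u v.
  move=> uv; have := mc _ _ uv; have := mc' _ _ uv.
  have [lu|gu|eu] := ltngtP u x; have [lv|gv|ev] := ltngtP v x;
    rewrite ?(deq _ eu) ?(deq _ ev) ?(dlt _ lu) ?(dlt _ lv) ?(dgt _ gu) ?(dgt _ gv) //;
    try lia.
  - by rewrite (val_inj ev); lia.
  - by rewrite (val_inj eu); lia.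
move=> uv Fuv; have := pc _ _ uv Fuv; have := pc' _ _ uv Fuv.
have := mc _ _ (ltnW uv); have := mc' _ _ (ltnW uv); rewrite -!val_eqE /=.
have [lu|gu|eu] := ltngtP u x; have [lv|gv|ev] := ltngtP v x;
  rewrite ?(deq _ eu) ?(deq _ ev) ?(dlt _ lu) ?(dlt _ lv) ?(dgt _ gu) ?(dgt _ gv) //;
  try lia.
- rewrite (val_inj ev); lia.
- rewrite (val_inj eu); lia.
Qed.

(** Testing the totals with the constant weight 1 shows that the list of colourings is nonempty. *)
Lemma profile_col (V : finType) (B : graph V) (k : nat) (p : V -> 'I_k) (j : 'I_k) :
  complete_partite B p ->
  tiling_colourings F p ->
  exists c : {ffun 'I_m -> 'I_k}, interval_col F c.
Proof.
move=> Bp profB.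
have [b [[|c cs] [b0 hcs]]] := profB 1%g; last by exists c; apply: hcs; rewrite inE eqxx.
move=> /(_ int (fun=> 1)) /eqP; rewrite big_nil eq_sym mulf_eq0 pnatr_eq0 gtn_eqF //=.
rewrite sumr_const pnatr_eq0 -[#|_|]/#|V|.
by have [v _] := Bp.1 j; rewrite -leqn0 leqNgt; case/negP; apply/card_gt0P; exists v.
Qed.

(* If the first [i] classes always consisted of the same vertices, then the
   first [i] parts of the bottle graph would have the same total size in every
   order of the parts. *)
Lemma bottle_movable (V : finType) (B : graph V) (k : nat) (p : V -> 'I_k) (i : 'I_k) :
  (0 < m)%N -> complete_partite B p -> (0 < i)%N ->
  tiling_colourings F p ->
  (exists j1 j2, #|part p j1| != #|part p j2|) ->
  exists (c c' : {ffun 'I_m -> 'I_k}) u, [/\ interval_col F c, interval_col F c', (c' u < i)%N & (i <= c u)%N].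
Proof.
move=> m0 Bp i0 profB [j1 [j2 ne]].
apply: contrapT => none.
have pre (c c' : {ffun 'I_m -> 'I_k}) : interval_col F c -> interval_col F c' ->
    \sum_u (c u < i)%:R = \sum_u (c' u < i)%:R :> int.
  move=> hc hc'; apply: eq_bigr => u _; congr (nat_of_bool _)%:R.
  apply/idP/idP => lt; apply: contra_notT none; rewrite -leqNgt => ge.
    by exists c', c, u.
  by exists c, c', u.
have [c0 hc0] := profile_col j1 Bp profB.
set t := \sum_u (c0 u < i)%:R : int.
(* Compare two weights: the constant 1 counts the colourings, and the indicator of the first [i]
   positions then gives the size of the first [i] parts. *)
have key (s : 'S_k) : m%:R * \sum_j #|part p j|%:R * (s j < i)%:R = #|V|%:R * t :> int.
  have [b [cs [b0 hcs prof]]] := profB s.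
  have := prof int (fun=> 1).
  under eq_bigr do rewrite sumr_const card_ord.
  rewrite big_const_seq iter_addr_0 sumr_const count_predT -[#|_|]/#|V| => E1.
  have := prof int (fun a => (a < i)%:R).
  have -> : \sum_(c <- cs) \sum_u (c u < i)%:R = t *+ size cs.
    rewrite -[size cs]count_predT -iter_addr_0 -big_const_seq.
    by apply: eq_big_seq => c /hcs hc; apply: pre.
  rewrite (sum_part p (fun j => (s j < i)%:R)).
  have -> : \sum_j (s j < i)%:R *+ #|part p j| = \sum_j #|part p j|%:R * (s j < i)%:R :> int.
    by apply: eq_bigr => j _; rewrite mulr_natl.
  move=> E2; apply: (mulfI (_ : b%:R != 0)); first by rewrite pnatr_eq0 -lt0n.
  rewrite mulrCA -E2 mulrA -E1.
  by rewrite -(mulr_natr t) -(mulr_natr m%:R); ring.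
have j12 : j1 != j2 by apply: contraNneq ne => ->.
(* Place [j1] and [j2] on the two sides of the boundary, at [i - 1] and [i]; swapping them changes
   the size of the first [i] parts. *)
pose i' : 'I_k := Ordinal (leq_ltn_trans (leq_pred i) (ltn_ord i)).
have i'i : i' != i by rewrite -val_eqE /= ltn_eqF // prednK.
have [s [s1 s2]] : exists s : 'S_k, s j1 = i' /\ s j2 = i.
  exists (tperm j1 i' * tperm (tperm j1 i' j2) i)%g; split; rewrite permM; last by rewrite tpermL.
  rewrite tpermL (tpermD (z := i')) //; last by rewrite eq_sym.
  apply: contraNneq j12 => E; apply/eqP/(@perm_inj _ (tperm j1 i')).
  by rewrite E tpermL.
have := key s; have := key (tperm j1 j2 * s)%g.
move=> <- /mulfI; rewrite pnatr_eq0 gtn_eqF // => /(_ isT).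
rewrite (bigD1 j1) //= (bigD1 j2) 1?eq_sym //= [RHS](bigD1 j1) //= [in RHS](bigD1 j2) 1?eq_sym //=.
rewrite !permM tpermL tpermR s1 s2 /= ltnn prednK // leqnn !mulr0 !mulr1 add0r.
set A := \sum_(j | _) _; set A' := \sum_(j | _) _.
have -> : A = A'.
  by apply: eq_bigr => j /andP[h1 h2]; rewrite permM tpermD // eq_sym.
rewrite add0r => /addIr/eqP; rewrite eqr_nat; exact/negP.
Qed.

End Div.

(** * The critical chromatic number of complete multipartite graphs *)

Section ChiCr.
Variables (R : realType) (V : finType) (B : graph V) (k : nat) (p : V -> 'I_k.+2).
Hypothesis Bp : complete_partite B p.

Lemma chi_cr_partite : exists2 i0, (forall i, #|part p i0| <= #|part p i|)%N &
  chi_cr B R = k.+1%:R / (1 - #|part p i0|%:R / #|V|%:R) /\ (#|part p i0| < #|V|)%N.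
Proof.
have [i0 hi0 mc] := min_class_partite Bp isT; exists i0 => //; split.
  by rewrite /chi_cr /tau mc (chi_partite Bp) -natr1 addrK.
rewrite (card_parts p) (bigD1 i0) //= -[ltnLHS]addn0 ltn_add2l.
have [i ii0] : exists i, i != i0.
  by exists (lift i0 ord0); rewrite eq_sym neq_lift.
by rewrite (bigD1 i) //= ltn_addr // (card_part_gt0 Bp).
Qed.

Lemma chi_cr_ge : k.+1%:R <= chi_cr B R.
Proof.
have [i0 _ [-> lt]] := chi_cr_partite.
have V0 : 0 < #|V|%:R :> R by rewrite ltr0n; apply: leq_ltn_trans lt.
have lt1 : #|part p i0|%:R / #|V|%:R < 1 :> R by rewrite ltr_pdivrMr // mul1r ltr_nat.
rewrite ler_pdivlMr ?subr_gt0 // ler_piMr //.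
by rewrite gerBl divr_ge0.
Qed.

(** Used in contrapositive: a value below the number of parts forces two parts of different
    sizes. *)
Lemma chi_cr_balanced : (forall i j, #|part p i| = #|part p j|) ->
  chi_cr B R = k.+2%:R.
Proof.
move=> eqp; have [i0 _ [-> lt]] := chi_cr_partite.
have -> : #|V| = (k.+2 * #|part p i0|)%N.
  rewrite (card_parts p) -[X in (X * _)%N]card_ord -sum_nat_const.
  by apply: eq_bigr => i _.
have P0 : #|part p i0|%:R != 0 :> R by rewrite pnatr_eq0 -lt0n (card_part_gt0 Bp).
rewrite natrM -[k.+2%:R]natr1; field.
by rewrite P0 addrK nat1r natr1 !pnatr_eq0.
Qed.

End ChiCr.

(** * Integer tilings from an unbalanced bottle graph *)

Section DivBottle.
Variables (R : realType) (m : nat) (F : ograph m).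

Lemma Div_deg_bottle n (G : ograph n) (V : finType) (B : graph V) :
  (0 < m)%N -> (3 <= ochi F)%N -> (0 < n)%N ->
  bottle_graph F B -> (2 <= chi B)%N -> chi_cr B R < (ochi F)%:R ->
  (forall v, ((ochi F).-1 * #|[set u | ~~ G v u]|.+1 <= n)%N) -> (m %| n)%N ->
  Div (HOrd F G).
Proof.
move=> m0 r3 n1 /bottle_profile[k [p [Bp profB]]].
rewrite (chi_partite Bp) => k2 crB deg mn.
case: k k2 p Bp profB => [|[|k]] // _ p Bp profB.
have [c0 hc0] := profile_col ord0 Bp profB.
(* Colouring [F] by the parts gives one inequality; the other follows from
   [k + 1 <= chi_cr B R < ochi F]. *)
have kr : ochi F = k.+2.
  apply/eqP; rewrite eqn_leq (ochi_le hc0) /=.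
  by have := le_lt_trans (chi_cr_ge R Bp) crB; rewrite ltr_nat.
rewrite kr /= in deg crB r3.
have uneq : exists j1 j2, #|part p j1| != #|part p j2|.
  apply: contrapT => eqp; move: crB; rewrite (chi_cr_balanced R Bp) ?ltxx // => i j.
  by apply/eqP; apply: contra_notT eqp => ne; exists i, j.
have n0 : (0 < #|'I_n|)%N by rewrite card_ord.
have deg' u : (k.+1 * #|[set w | ~~ G u w]|.+1 <= #|'I_n|)%N by rewrite card_ord.
have enum_edge (a b : 'I_n) : G a b -> exists (h : 'I_k.+2 -> 'I_n) (i j : 'I_k.+2),
    [/\ {homo h : x y / (x < y)%N >-> (x < y)%N}, h i = a, h j = b
      & forall x y, x != y -> G (h x) (h y)].
  move=> ab; have ne : a != b by apply: contraTneq ab => ->; rewrite adj_irr.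
  have [|W [cW SW WW]] := @clique_ext _ G k.+1 isT n0 deg' [set a; b] k.
    by rewrite cards2 ne.
  have [||h [i [j [hh hi hj hG]]]] := near_clique_enum cW ne _ _ WW.
  - by move=> w; apply: SW; rewrite !inE eqxx.
  - by move=> w; apply: SW; rewrite !inE eqxx orbT.
  exists h, i, j; split=> // x y xy.
  have [/andP[/eqP-> /eqP->]|n2] := boolP ((x == i) && (y == j)); first by rewrite hi hj.
  have [/andP[/eqP-> /eqP->]|n3] := boolP ((x == j) && (y == i)); last exact: hG.
  by rewrite hi hj adj_sym.
have homE (h : 'I_k.+2 -> 'I_n) (c : {ffun 'I_m -> 'I_k.+2}) :
    {homo h : x y / (x < y)%N >-> (x < y)%N} ->
    (forall x y, x != y -> G (h x) (h y)) -> interval_col F c ->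
    [ffun u => h (c u)] \in HOrd F G.
  move=> hh hG hc; apply: HOrd_comp => // [x y /hh/ltnW//|u v uv].
  exact/hG/(interval_col_neq hc).
have edge (a b : 'I_n) : G a b -> transferable (HOrd F G) a b.
  move=> /enum_edge[h [i [j [hh <- <- hG]]]].
  suff tr0 x : transferable (HOrd F G) (h ord0) (h x).
    exact: transferable_trans (transferable_sym (tr0 i)) (tr0 j).
  case: x => x; elim: x => [|x IH] lt.
    by have -> : Ordinal lt = ord0; [apply: val_inj|apply: transferable_refl].
  apply: transferable_trans (IH (ltnW lt)) _.
  (* Some [u] has colour at most [x] under [c'] and at least [x + 1] under [c], so splicing can give
     it either of these two colours. *)
  have [c [c' [u [hc hc' c'u cu]]]] := bottle_movable (i := Ordinal lt) m0 Bp isT profB uneq.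
  have [||d1 [hd1 d1u d1E]] := @splice_colouring _ F _ c c' u (Ordinal (ltnW lt)) hc hc'.
  - by [].
  - exact: ltnW.
  have [||d2 [hd2 d2u d2E]] := @splice_colouring _ F _ c c' u (Ordinal lt) hc hc'.
  - exact: ltnW.
  - by [].
  (* Away from [u] the spliced colours do not depend on the colour prescribed at [u], so the two
     edges differ in one entry. *)
  have := @transferable_edges _ _ _ _ _ u (homE _ _ hh hG hd1) (homE _ _ hh hG hd2).
  rewrite !ffunE d1u d2u; apply=> w wu.
  by rewrite !ffunE d1E // d2E.
(* Two vertices number at most [k + 1] because [ochi F >= 3], so any two vertices are joined through
   a common neighbour. *)
have common (a b : 'I_n) : exists w, G a w /\ G b w.
  have S2 : (#|[set a; b]| <= k.+1)%N by rewrite cards2; case: (a != b) => //; exact: r3.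
  have /(leq_trans (ltn0Sn _))/card_gt0P[w] := @common_nbrs _ G k.+1 isT n0 deg' _ S2.
  rewrite inE => /forall_inP h; exists w.
  by split; apply: h; rewrite !inE eqxx ?orbT.
have [e0 e0H] : exists e, e \in HOrd F G.
  have [w [/enum_edge[h [_ [_ [hh _ _ hG]]]] _]] := common (Ordinal n1) (Ordinal n1).
  by exists [ffun u => h (c0 u)]; apply: homE.
apply: (Div_transferable e0H); rewrite ?card_ord // => a b.
have [w [aw bw]] := common a b.
exact: transferable_trans (edge _ _ aw) (transferable_sym (edge _ _ bw)).
Qed.

End DivBottle.

(** * From minimum degree to thresholds *)

(** Of the slack 2, one unit pays for [v], a non-neighbour of itself, and the other for the
    successor in the conclusion. *)
Lemma nonadj_deg (R : realType) n (G : ograph n) (x mu : R) v :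
  1 <= x -> 2 <= mu * (n%:R - 1) ->
  min_degree_ge G ((1 - 1 / x + mu) * (n%:R - 1)) ->
  x * #|[set u | ~~ G v u]|.+1%:R <= n%:R.
Proof.
move=> x1 hmu /(_ v) deg; have x0 : 0 < x by lra.
have E : #|[set u | ~~ G v u]|%:R = n%:R - #|[set u | G v u]|%:R :> R.
  rewrite -[in n%:R](card_ord n) -(cardsC [set u | G v u]) natrD addrC addKr.
  by congr _%:R; apply: eq_card => u; rewrite !inE.
rewrite -natr1 E -(ler_pM2l (_ : 0 < x^-1)) ?invr_gt0 // mulKf ?gt_eqF //.
have xV : 0 < x^-1 by rewrite invr_gt0.
by move: deg; rewrite div1r; nra.
Qed.

Lemma large_order (R : realType) (mu : R) : 0 < mu ->
  exists2 n0, (0 < n0)%N & forall n, (n0 <= n)%N -> 2 <= mu * (n%:R - 1).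
Proof.
move=> mu0; pose n0 := (Num.truncn (mu^-1 * 2)).+2.
exists n0 => // n hn; rewrite -ler_pdivrMl // lerBrDr.
apply: (@le_trans _ _ n0%:R); last by rewrite ler_nat.
by rewrite /n0 -[leRHS]natr1 lerD2r ltW // truncnS_gt.
Qed.

Section Threshold.
Variables (R : realType) (m : nat) (F : ograph m) (adm : pred nat).
Variable P : R -> forall n, mdigraph m 'I_n -> Prop.

(** By [nonadj_deg], [1 - 1 / x] lies in the set whose infimum is the threshold, and [0] bounds that
    set below. *)
Lemma threshold_le (x : R) : 1 <= x ->
  (forall mu : R, 0 < mu -> forall n, (0 < n)%N -> adm n -> forall G : ograph n,
     (forall v, x * #|[set u | ~~ G v u]|.+1%:R <= n%:R) -> P mu (HOrd F G)) ->
  threshold F adm P <= 1 - 1 / x.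
Proof.
move=> x1 hP; apply: ge_inf.
  by exists 0 => d [/andP[]].
have x0 : 0 < x by apply: lt_le_trans x1.
split; first by rewrite subr_ge0 gerBl div1r invf_le1 // x1 invr_ge0 ltW.
move=> mu mu0; have [n0 n00 hn0] := large_order mu0; exists n0 => n hn adn G deg.
apply: hP => // [|v]; first exact: leq_trans hn.
exact: (nonadj_deg _ x1 (hn0 _ hn) deg).
Qed.

Lemma threshold_le_nat q : (0 < q)%N ->
  (forall mu : R, 0 < mu -> forall n, (0 < n)%N -> adm n -> forall G : ograph n,
     (forall v, (q * #|[set u | ~~ G v u]|.+1 <= n)%N) -> P mu (HOrd F G)) ->
  threshold F adm P <= 1 - 1 / q%:R.
Proof.
move=> q0 hP; apply: threshold_le => [|mu mu0 n n0 adn G deg]; first by rewrite ler1n.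
by apply: hP => // v; rewrite -(ler_nat R) natrM.
Qed.

End Threshold.

Lemma chi_cr_ge1 (R : realType) m (F : ograph m) (V : finType) (B : graph V) :
  bottle_graph F B -> (2 <= chi B)%N -> 1 <= chi_cr B R.
Proof.
move=> [k [p [Bp _]]]; rewrite (chi_partite Bp).
case: k p Bp => [|[|k]] // p Bp _.
by apply: le_trans (chi_cr_ge R Bp); rewrite ler1n.
Qed.

Lemma complete_sym (V : finType) : symmetric (fun u v : V => u != v).
Proof. by move=> u v; rewrite eq_sym. Qed.

Lemma complete_irr (V : finType) : irreflexive (fun u v : V => u != v).
Proof. by move=> u; rewrite eqxx. Qed.

Definition complete (V : finType) : graph V :=
  Graph (@complete_sym V) (@complete_irr V).

(** Makes the set defining [ochi_cr] nonempty. For [b = 1] each ordered blow-up is a clique on [m]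
    vertices, which a single copy of [F] covers. *)
Lemma bottle_complete m (F : ograph m) : bottle_graph F (complete 'I_m).
Proof.
exists m, id; split; first by split=> // i; exists i.
move=> s; exists 1%N; split=> //.
have E : #|{: 'I_m * 'I_1}| = m by rewrite card_prod !card_ord muln1.
pose f (x : 'I_#|{: 'I_m * 'I_1}|) : 'I_m * 'I_1 := ((s^-1)%g (cast_ord E x), ord0).
exists f; split.
- exists (fun a => cast_ord (esym E) (s a.1)) => [x|[a b]].
    by rewrite /f /= permKV cast_ordK.
  by rewrite /f /= cast_ordKV permK (ord1 b).
- by move=> x y /ltnW; rewrite /f /= !permKV.
- exists [set [ffun u => cast_ord (esym E) u]]; split.
  + move=> phi /set1P->; split; last by move=> u v; rewrite !ffunE => /cast_ord_inj.
    apply/andP; split; apply/forallP=> u; apply/forallP=> v; apply/implyP; rewrite !ffunE.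
      move=> uv; rewrite /= /pullback_adj /= /pullback_adj /= (inj_eq perm_inj).
      rewrite (inj_eq (@cast_ord_inj _ _ _)) (inj_eq (@cast_ord_inj _ _ _)).
      by apply: contraTneq uv => ->; rewrite adj_irr.
    by move/ltnW.
  + by move=> phi psi /set1P-> /set1P->; rewrite eqxx.
  + move=> v; exists [ffun u => cast_ord (esym E) u]; first by rewrite set11.
    by apply/codomP; exists (cast_ord E v); rewrite ffunE cast_ordK.
Qed.

Lemma chi_complete m : chi (complete 'I_m) = m.
Proof.
by apply: (@chi_partite _ _ _ id); split=> // i; exists i.
Qed.

Theorem proposition4p14 (R : realType) (m : nat) (F : ograph m)
    (hF : (3 <= ochi F)%N) :
  [/\ delta_Spa R F <= 1 - 1 / ochi_cr F R,
      delta_Div R F <=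
        (if ochi_cr F R < (ochi F)%:R then 1 - 1 / ((ochi F)%:R - 1)
         else 1 - 1 / (ochi F)%:R)
    & delta_Cov R F <=
        (if ordered_cone F then 1 - 1 / ((ochi F)%:R - 1)
         else 1 - 1 / (ochi F)%:R)].
Proof.
have r0 : (0 < ochi F)%N by apply: ltn_trans hF.
have hm : (3 <= m)%N := leq_trans hF (ochi_le_size F).
have m0 : (0 < m)%N by apply: ltn_trans hm.
have q0 : (0 < (ochi F).-1)%N by case: (ochi F) hF => [|[]].
have qE : (ochi F)%:R - 1 = (ochi F).-1%:R :> R.
  by rewrite -[in LHS](prednK r0) -natr1 addrK.
rewrite qE; set S : classical_sets.set R := fun x => exists (V : finType) (B : graph V),
  [/\ (2 <= chi B)%N, bottle_graph F B & x = chi_cr B R].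
have crE : ochi_cr F R = inf S by [].
have S0 : classical_sets.nonempty S.
  exists (chi_cr (complete 'I_m) R), 'I_m, (complete 'I_m); split=> //.
    by rewrite chi_complete ltnW.
  exact: bottle_complete.
split.
- have h x : S x -> delta_Spa R F <= 1 - 1 / x.
    move=> [V [B [B2 botB ->]]].
    apply: threshold_le => [|mu mu0 n n0 _ G deg]; first exact: chi_cr_ge1 botB B2.
    apply: Spa_of_dual => // [|y hy]; first exact: ltW.
    apply: (bottle_sum_ge0 botB B2 _ hy) => v; apply: le_trans (deg v).
    rewrite ler_wpM2l ?ler_nat //.
    by apply: le_trans (chi_cr_ge1 R botB B2).
  have x1 x : S x -> 1 <= x by move=> [V [B [B2 botB ->]]]; apply: chi_cr_ge1 botB B2.
  have lt1 : delta_Spa R F < 1.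
    have [x Sx] := S0; apply: le_lt_trans (h x Sx) _.
    by rewrite ltrBlDr ltrDl divr_gt0 // (lt_le_trans _ (x1 _ Sx)).
  have d0 : 0 < 1 - delta_Spa R F by rewrite subr_gt0.
  (* Inverting the bound for each bottle graph gives a lower bound of [S], which passes to the
     infimum whether or not it is attained. *)
  have le : (1 - delta_Spa R F)^-1 <= inf S.
    apply: lb_le_inf => // x Sx; have x0 : 0 < x by rewrite (lt_le_trans _ (x1 _ Sx)).
    rewrite invf_ple ?posrE //; have := h x Sx; lra.
  have inf0 : 0 < inf S by apply: lt_le_trans le; rewrite invr_gt0.
  by rewrite crE lerBrDr -lerBrDl div1r invf_ple ?posrE.
- case: ifP => [lt|_].
    (* An infimum below [ochi F] yields an actual bottle graph with critical chromatic number below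
       [ochi F]. *)
    have [x [V [B [B2 botB ->]]] xr] : exists2 x, S x & x < (ochi F)%:R.
      apply: contrapT => none; move: lt; rewrite ltNge crE lb_le_inf // => x Sx.
      by rewrite leNgt; apply/negP => xr; apply: none; exists x.
    apply: threshold_le_nat => // mu _ n n0 mn G deg.
    exact: Div_deg_bottle m0 hF n0 botB B2 xr deg mn.
  apply: threshold_le_nat => // mu _ n n0 mn G deg.
  by apply: Div_deg => //; apply: ltnW.
- case: ifP => [cone|_]; apply: threshold_le_nat => // mu _ n n0 _ G deg.
    exact: Cov_deg_cone.
  exact: Cov_deg.
Qed.
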